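(* Let $X$ be a linearly ordered set and let $\mathbb{K}(X)$ be the compact line of all final segments of $X$. Then $\mathbb{K}(X)$ is Valdivia compact if and only if the following three conditions are satisfied. (1) $|X|\le\aleph_1$. (2) Every bounded monotone $\omega_1$-sequence in $X$ has a limit in $X$; that is, every increasing sequence $(x_\alpha)_{\alpha<\omega_1}$ in $X$ which is bounded from above in $X$ has a supremum in $X$, and every decreasing sequence $(x_\alpha)_{\alpha<\omega_1}$ in $X$ which is bounded from below in $X$ has an infimum in $X$. (3) For every stationary set $S\subseteq\omega_1$ and every map $f\colon S\to X$ there is a stationary set $T\subseteq S$ such that $f|_T$ is monotone.
   Context: A compact space $K$ is Valdivia (compact) if there are a set $\Gamma$ and a homeomorphism of $K$ onto some $K'\subseteq\mathbb{R}^\Gamma$ such that $\{x\in K' : \{\gamma\in\Gamma : x(\gamma)\neq 0\}\text{ is countable}\}$ is dense in $K'$. For a linearly ordered set $X$, $\mathbb{K}(X)$ denotes the set of all final segments of $X$ (sets $F\subseteq X$ such that $x\in F$ and $x\le y$ imply $y\in F$; $\emptyset$ and $X$ are included), with the topology inherited from the Cantor cube $\{0,1\}^X$ by identifying each final segment with its characteristic function. It is ordered by inverse inclusion, and is a zero-dimensional compact line (a compact space whose topology is induced by its linear order). A map $f$ between linearly ordered sets is increasing if $x\le y$ implies $f(x)\le f(y)$ (not necessarily strictly), decreasing if $x\le y$ implies $f(x)\ge f(y)$, and monotone if it is increasing or decreasing. A subset of $\omega_1$ is stationary if it meets every closed unbounded subset of $\omega_1$. *)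

(* Defs.v *)
From HB Require Import structures.
From mathcomp Require Import all_boot all_order all_algebra.
From mathcomp Require Import wochoice all_classical all_reals all_analysis.

Set Implicit Arguments.
Unset Strict Implicit.
Unset Printing Implicit Defensive.

Import Order.TTheory GRing.Theory Num.Theory.
Import numFieldNormedType.Exports.

Local Open Scope classical_set_scope.
Local Open Scope ring_scope.

(* [omega1] is realized as the set of points of a fixed well-ordering of 2^nat
   with only countably many predecessors.  The lemmas [omega1_minimum],
   [omega1_initial_countable] and [omega1_uncountable] characterize it up to
   isomorphism as the first uncountable ordinal. *)

Definition wo_rel : rel (nat -> bool) :=
  projT1 (well_ordering_principle (nat -> bool)).

Lemma wo_relP : well_order wo_rel.
Proof. exact: projT2 (well_ordering_principle (nat -> bool)). Qed.

Lemma wo_rel_min (A : set (nat -> bool)) :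
  A !=set0 -> exists2 z, A z & forall y, A y -> wo_rel z y.
Proof.
case=> x Ax; have [|z [[zA lz] _]] := @wo_relP (mem A).
  by exists x; rewrite !inE.
move: zA; rewrite !inE => zA; exists z => // y Ay; apply: lz; exact/mem_set.
Qed.

Lemma wo_rel_total : total wo_rel.
Proof.
move=> x y; have [|z zxy zmin] := @wo_rel_min [set x; y].
  by exists x; left.
by case: zxy => zE; rewrite -{1 2}zE ?zmin ?orbT //; [right | left].
Qed.

Lemma wo_rel_refl : reflexive wo_rel.
Proof. by move=> x; have := wo_rel_total x x; rewrite orbb. Qed.

Lemma wo_rel_anti : antisymmetric wo_rel.
Proof.
move=> x y /andP[xy yx]; have [|z [_ zu]] := @wo_relP (mem [set x; y]).
  by exists x; rewrite !inE; left.
rewrite -(zu x); last first.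
  split; first by rewrite !inE; left.
  by move=> t; rewrite !inE => -[->|->] //; exact: wo_rel_refl.
apply: zu; split; first by rewrite !inE; right.
by move=> t; rewrite !inE => -[->|->] //; exact: wo_rel_refl.
Qed.

Lemma wo_rel_trans : transitive wo_rel.
Proof.
move=> y x z xy yz.
have [|w ww wmin] := @wo_rel_min [set t | [\/ t = x, t = y | t = z]].
  by exists x; exact: Or31.
have [xw yw zw] : [/\ wo_rel w x, wo_rel w y & wo_rel w z].
  by split; apply: wmin; [exact: Or31|exact: Or32|exact: Or33].
case: ww => E; first by rewrite -E.
  by rewrite (@wo_rel_anti x y) // xy -E xw.
by rewrite -(@wo_rel_anti y z) // yz -E yw.
Qed.

Definition omega1 : Type :=
  {x : nat -> bool | `[< countable [set y | wo_rel y x] >]}.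

HB.instance Definition _ := SubType.copy omega1
  {x : nat -> bool | `[< countable [set y | wo_rel y x] >]}.
HB.instance Definition _ := [Choice of omega1 by <:].

Definition omega1_le : rel omega1 := fun a b => wo_rel (val a) (val b).

Lemma omega1_le_refl : reflexive omega1_le.
Proof. by move=> a; exact: wo_rel_refl. Qed.

Lemma omega1_le_anti : antisymmetric omega1_le.
Proof. by move=> a b /wo_rel_anti/val_inj. Qed.

Lemma omega1_le_trans : transitive omega1_le.
Proof. by move=> b a c; exact: wo_rel_trans. Qed.

Lemma omega1_le_total : total omega1_le.
Proof. by move=> a b; exact: wo_rel_total. Qed.

Fact omega1_display : Order.disp_t. Proof. exact: (Order.Disp tt tt). Qed.

HB.instance Definition _ := Order.Le_isPOrder.Build omega1_display omega1
  omega1_le_refl omega1_le_anti omega1_le_trans.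
HB.instance Definition _ :=
  Order.POrder_isTotal.Build omega1_display omega1 omega1_le_total.

Lemma omega1_minimum (A : set omega1) :
  A !=set0 -> exists2 a, A a & forall b, A b -> (a <= b)%O.
Proof.
case=> a Aa; have [|z [b Ab <-] zmin] := @wo_rel_min (val @` A).
  by exists (val a), a.
by exists b => // c Ac; apply: zmin; exists c.
Qed.

Lemma omega1_initial_countable (a : omega1) : countable [set b | (b <= a)%O].
Proof.
have /asboolP/countable_injP[f finj] := valP a.
apply/countable_injP; exists (f \o val) => b c; rewrite !inE => ba ca /= fbc.
by apply/val_inj/finj => //; exact/mem_set.
Qed.

Lemma omega1_uncountable : ~ countable [set: omega1].
Proof.
move=> cW; pose W := [set x | countable [set y | wo_rel y x]].
have cW' : countable W.
  case/countable_injP: cW => f finj.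
  pose g x := if insub x is Some a then f (a : omega1) else 0%N.
  apply/countable_injP; exists g => x y.
  rewrite !inE /g => Wx Wy.
  rewrite !insubT; [exact/asboolP|exact/asboolP|move=> Wy' Wx' fE].
  have := finj _ _ (in_setT _) (in_setT _) fE.
  by move=> /(congr1 val).
have [nW|nW] := pselect (exists x, ~ W x); last first.
  have allW x : W x by apply: contrapT => nWx; apply: nW; exists x.
  case/countable_injP: cW' => f finj.
  have {}finj : injective f.
    by move=> x y; apply: finj; apply/mem_set/allW.
  pose h (n : nat) : bool := `[< exists2 x, f x = n & x n = false >].
  have := erefl (h (f h)); rewrite {1}/h.
  case: asboolP => [[x /finj -> ->] //|nh] hE.
  by apply: nh; exists h.
have [z nWz zmin] := @wo_rel_min (~` W) nW.
apply: nWz; pose F (i : bool) := if i then W else [set z].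
apply: (@sub_countable _ _ _ (\bigcup_(i in [set: bool]) F i)).
  apply: subset_card_le => y /= yz.
  have [->|/eqP yNz] := eqVneq y z; first by exists false.
  exists true => //; apply: contrapT => nWy; apply: yNz; apply: wo_rel_anti.
  by rewrite yz; exact: zmin.
by apply: bigcup_countable => // -[_|_] //=; exact: countable1.
Qed.

Definition club (C : set omega1) : Prop :=
  @closed (order_topology omega1) C /\ forall a, exists2 b, C b & (a < b)%O.

Definition stationary (S : set omega1) : Prop :=
  forall C, club C -> S `&` C !=set0.

Definition final_segment d (X : orderType d) (F : X -> bool) : Prop :=
  forall x y : X, (x <= y)%O -> F x -> F y.

(* As a subset of the Cantor cube; the coercion of sets to types equips it with
   the topology inherited from the product topology. *)
Definition KK d (X : orderType d) : set (prod_topology (fun _ : X => bool)) :=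
  [set F | final_segment F].
Arguments KK {d} X.

Definition homeomorphic (S T : topologicalType) : Prop :=
  exists (f : S -> T) (g : T -> S),
    [/\ cancel f g, cancel g f, continuous f & continuous g].

Definition valdivia (R : realType) (K : topologicalType) : Prop :=
  compact [set: K] /\
  exists (Gamma : Type) (K' : set (prod_topology (fun _ : Gamma => R))),
    homeomorphic K K' /\
    dense [set x : K' | countable [set g : Gamma | \val x g != 0]].

(* Main.v *)
(* Call a set A of points of X retractable if every point outside A has, on at
   least one side, either a nearest point of A or no point of A at all; these are
   the A for which K(X) -> K(A) has a continuous section.  Valdivia compactness
   of K(X) and the three conditions are both equivalent to the existence of an
   injection rho : X -> omega1 such that {rho < a} is retractable for club many a.

   From the filtration to K(X): each x has a parent, a point of smaller rank (or a
   formal endpoint) neighbouring x.  Sending F to the indicator of the points at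
   which F and its value at the parent differ embeds K(X) in R^X, and the final
   segments determined by countably many points are dense with countable support.

   From K(X) to the filtration: continuous real functions on K(X) give a family J
   of clopen intervals which separates K(X) and is point-countable on a dense set
   D.  If A contains the endpoints of all members of J meeting a chosen element of
   D between any two points of A, then A is retractable, since otherwise a
   two-sided gap of A could not be split by J.  The bound on the cardinality comes
   from the fact that every cut of X has cofinality at most omega1: otherwise
   uncountably many members of J would contain the same element of D.

   The three conditions are matched with the filtration by Fodor's lemma. *)
Require Import Defs.
From mathcomp Require Import all_boot all_order all_algebra.
From mathcomp Require Import all_classical all_reals all_analysis.

Set Implicit Arguments.
Unset Strict Implicit.
Unset Printing Implicit Defensive.

Import Order.TTheory GRing.Theory Num.Theory.
Import numFieldNormedType.Exports.

Local Open Scope classical_set_scope.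
Local Open Scope order_scope.

(** * Closed unbounded and stationary subsets of [omega1] *)

Lemma omega1_wf : well_founded (fun a b : omega1 => a < b).
Proof.
move=> a; apply: contrapT => na.
have [|b nb bmin] := @omega1_minimum [set b | ~ Acc (fun a b : omega1 => a < b) b].
  by exists a.
apply: nb; constructor => c cb; apply: contrapT => /bmin.
by rewrite leNgt cb.
Qed.

Lemma omega1_bound (A : set omega1) : countable A ->
  exists b, forall a, A a -> a < b.
Proof.
move=> cA; apply: contrapT => nb; apply: omega1_uncountable.
apply: (@sub_countable _ _ _ (\bigcup_(a in A) [set b | b <= a])); last first.
  by apply: bigcup_countable => // a _; exact: omega1_initial_countable.
apply: subset_card_le => b _; apply: contrapT => bA.
apply: nb; exists b => a Aa; rewrite ltNge; apply/negP => ba.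
by apply: bA; exists a.
Qed.

Lemma countable_image {T U} (f : T -> U) (A : set T) :
  countable A -> countable (f @` A).
Proof. exact/sub_countable/card_image_le. Qed.

Lemma countable_setU {T} (A B : set T) :
  countable A -> countable B -> countable (A `|` B).
Proof.
move=> cA cB; rewrite -bigcup2E; apply: bigcup_countable => // i _.
by rewrite /bigcup2; case: i => [|[|i]] //=; exact: countable0.
Qed.

Lemma omega1_bound_seq (u : nat -> omega1) : exists b, forall n, u n < b.
Proof.
have [|b bu] := @omega1_bound (range u); first exact/countable_image/countableP.
by exists b => n; apply: bu; exists n.
Qed.

Lemma omega1_bound2 (a b : omega1) : exists c, a < c /\ b < c.
Proof.
have [c cu] := omega1_bound_seq (fun n => if n is 0%N then a else b).
by exists c; split; [exact: (cu 0%N)|exact: (cu 1%N)].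
Qed.

Lemma omega1_succ (a : omega1) : exists b, a < b /\ forall c, c < b -> c <= a.
Proof.
have [c [ac _]] := omega1_bound2 a a.
have [|b ab bmin] := @omega1_minimum [set b | a < b]; first by exists c.
by exists b; split => // e eb; rewrite leNgt; apply/negP => /bmin; rewrite leNgt eb.
Qed.

Lemma omega1_sup (u : nat -> omega1) : exists a,
  (forall n, u n <= a) /\ forall b, b < a -> exists n, b < u n.
Proof.
have [b bu] := omega1_bound_seq u.
have [|a ua amin] := @omega1_minimum [set b | forall n, u n <= b].
  by exists b => n; exact/ltW.
exists a; split => // c ca; apply: contrapT => nc.
suff : a <= c by rewrite leNgt ca.
by apply: amin => n; rewrite leNgt; apply/negP => cn; apply: nc; exists n.
Qed.

Lemma dependent_choice_from {T} (P : T -> T -> Prop) (a : T) :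
  (forall a, exists b, P a b) ->
  exists u : nat -> T, u 0%N = a /\ forall n, P (u n) (u n.+1).
Proof. by move=> /choice[f Pf]; exists (fun n => iter n f a). Qed.

(** [a] is the supremum of the part of [C] up to [a]; the first hypothesis takes care of the least
    [a], for which the second is vacuous. *)
Lemma closed_limit (C : set omega1) (a : omega1) :
  @closed (order_topology omega1) C ->
  (exists2 c, C c & c <= a) ->
  (forall b, b < a -> exists c, [/\ C c, b < c & c <= a]) -> C a.
Proof.
move=> cC [c Cc ca] lim.
pose A : set (order_topology omega1) := C `&` [set` `]-oo, a]].
suff [] : A a by [].
apply: (@itv_closed_supremums _ (order_topology omega1)).
- by exists c; split => //=; rewrite in_itv.
- by apply: closedI => //; exact: lray_closed.
- split.
    by move=> b [_ /=]; rewrite in_itv.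
  move=> b ub; rewrite leNgt; apply/negP => /lim[e [Ce be ea]].
  have : (e <= b)%O by apply: ub; split => //=; rewrite in_itv.
  by rewrite leNgt be.
Qed.

Lemma closed_limitP (C : set omega1) :
  (forall a, (exists2 c, C c & c <= a) ->
     (forall b, b < a -> exists c, [/\ C c, b < c & c <= a]) -> C a) ->
  @closed (order_topology omega1) C.
Proof.
move=> H a cla; have [s [sa smin]] := omega1_succ a.
apply: H.
  have [|c [Cc /=]] := cla [set` `]-oo, (s : order_topology omega1)[].
    by apply: open_nbhs_nbhs; split; [exact: lray_open|rewrite /= in_itv].
  by rewrite in_itv /= => /smin ?; exists c.
move=> b ba; have [|c [Cc /=]] :=
  cla [set` `](b : order_topology omega1), (s : order_topology omega1)[].
  apply: open_nbhs_nbhs; split; first exact: itv_open.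
  by rewrite /= in_itv; apply/andP.
by rewrite in_itv /= => /andP[bc /smin ca]; exists c.
Qed.

Lemma club_ge (a : omega1) : club [set b | a <= b].
Proof.
split; last first.
  move=> b; have [c [ac bc]] := omega1_bound2 a b.
  by exists c => //=; exact/ltW.
by apply: closed_limitP => b [c /= ac cb] _ /=; exact: le_trans cb.
Qed.

Lemma club_diagonal (a0 : omega1) (C0 : set omega1) (C : omega1 -> set omega1) :
  club C0 -> (forall c, club (C c)) ->
  club [set a | [/\ a0 < a, C0 a & forall c, c < a -> C c a]].
Proof.
move=> [clC0 unC0] clubC; split.
  apply: closed_limitP => a [c [a0c _ _] ca] lim; split.
  - exact: lt_le_trans ca.
  - apply: closed_limit => //.
      by have [|e [[_ C0e _] _ ea]] := lim a0; [exact: lt_le_trans ca|exists e].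
    by move=> b /lim[e [[_ C0e _] be ea]]; exists e.
  - move=> e ea; apply: closed_limit.
    + by case: (clubC e).
    + by have [g [[_ _ Cg] eg ga]] := lim _ ea; exists g => //; exact: Cg.
    + move=> b ba; have [|g [[_ _ Cg]]] := lim (Order.max b e).
        by rewrite gt_max ba ea.
      by rewrite gt_max => /andP[bg eg] ga; exists g; split => //; exact: Cg.
move=> a.
(* [y] is so far beyond [x] that [C0] and every [C g] with [g <= x] meet ]x, y]; the supremum of a
   [P]-chain is then a limit of [C0] and of every [C e] with [e] below it. *)
pose P (x y : omega1) := (exists c, [/\ C0 c, x < c & c <= y]) /\
  forall g, g <= x -> exists c, [/\ C g c, x < c & c <= y].
have exP x : exists y, P x y.
  have [c0 Cc0 xc0] := unC0 x.
  have /choice[f Pf] : forall g, exists c, C g c /\ x < c.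
    by move=> g; have [_ /(_ x)[c]] := clubC g; exists c.
  have [|y yb] := @omega1_bound (f @` [set g | g <= x]).
    exact/countable_image/omega1_initial_countable.
  have [z [c0z yz]] := omega1_bound2 c0 y.
  exists z; split; first by exists c0; split => //; exact/ltW.
  move=> g gx; exists (f g); have [Cg xg] := Pf g; split => //.
  by apply/ltW/(lt_trans _ yz)/yb; exists g.
have [u [u0 uP]] := dependent_choice_from (P := P) (Order.max a a0) exP.
have ulim n : u n < u n.+1.
  by have [[c [_ uc cu]] _] := uP n; exact: lt_le_trans cu.
have umono m n : (m <= n)%N -> u m <= u n.
  move=> mn; rewrite -(subnK mn); elim: (n - m)%N => // k IH.
  by rewrite addSn; exact: le_trans (ltW (ulim _)).
have [s [us slim]] := omega1_sup u.
have uls n : u n < s by exact: lt_le_trans (us n.+1).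
have aas : Order.max a a0 < s by rewrite -u0.
move: aas; rewrite gt_max => /andP[as' a0s].
exists s => //; split => //.
- apply: closed_limit => //.
    have [[c [C0c _ cu]] _] := uP 0%N.
    by exists c => //; exact: (le_trans _ (us 1%N)).
  move=> b /slim[n bn]; have [[c [C0c uc cu]] _] := uP n.
  exists c; split => //; first exact: lt_trans uc.
  exact: (le_trans _ (us n.+1)).
- move=> e es; have [clCe _] := clubC e.
  have key b : b < s -> exists c, [/\ C e c, b < c & c <= s].
    move=> bs; have [|n] := slim (Order.max b e); first by rewrite gt_max bs.
    rewrite gt_max => /andP[bn en].
    have [_ /(_ e (ltW en))[c [Cc uc cu]]] := uP n.
    exists c; split => //; first exact: lt_trans uc.
    exact: (le_trans _ (us n.+1)).
  apply: closed_limit => //.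
  by have [c [? _ ?]] := key _ es; exists c.
Qed.

Lemma club_closure (a0 : omega1) (C0 : set omega1) (Phi : omega1 -> set omega1) :
  club C0 -> (forall c, countable (Phi c)) ->
  exists C, club C /\ forall a, C a ->
    [/\ a0 < a, C0 a & forall c, c < a -> forall e, Phi c e -> e < a].
Proof.
move=> clubC0 cPhi.
have /choice[h hP] : forall c, exists b, forall e, Phi c e -> e < b.
  by move=> c; exact: omega1_bound.
eexists; split; first exact: (@club_diagonal a0 _ _ clubC0 (fun c => club_ge (h c))).
move=> a [a0a C0a H]; split => // c ca e /hP eh.
exact: lt_le_trans (H _ ca).
Qed.

Lemma stationaryS (S T : set omega1) : S `<=` T -> stationary S -> stationary T.
Proof. by move=> ST stS C /stS[a [Sa Ca]]; exists a; split => //; exact: ST. Qed.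

Lemma stationary_inhabited (S : set omega1) : stationary S -> exists a, S a.
Proof.
move=> stS; have [a0 _] : exists a : omega1, True.
  by have [a _] := @omega1_bound set0 (countable0 _); exists a.
by have [a [Sa _]] := stS _ (club_ge a0); exists a.
Qed.

Lemma stationaryI (S C : set omega1) :
  stationary S -> club C -> stationary (S `&` C).
Proof.
move=> stS clC C' clC'; have [a0 _] := stationary_inhabited stS.
(* For a constant family the diagonal intersection lies in [C']; [a0 < a] supplies the index
   required. *)
have [a [Sa [a0a Ca /(_ _ a0a) C'a]]] :=
  stS _ (club_diagonal a0 clC (fun=> clC')).
by exists a.
Qed.

Lemma nonstationary_club (S : set omega1) :
  ~ stationary S -> exists C, club C /\ forall a, C a -> ~ S a.
Proof.
move=> nS; apply: contrapT => nC; apply: nS => C clC; apply: contrapT => SC0.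
by apply: nC; exists C; split => // a Ca Sa; apply: SC0; exists a.
Qed.

Lemma stationaryU (S T : set omega1) :
  stationary (S `|` T) -> stationary S \/ stationary T.
Proof.
move=> stST; apply: contrapT => /not_orP[nS nT].
have [C [clC CS]] := nonstationary_club nS.
have [D [clD DT]] := nonstationary_club nT.
have [a [[[Sa|Ta] Ca] Da]] := stationaryI stST clC clD.
  exact: (CS a).
exact: (DT a).
Qed.

Lemma stationary_gt (S : set omega1) (a : omega1) :
  stationary S -> exists2 b, S b & a < b.
Proof.
have [c [ac _]] := omega1_bound2 a a.
by move=> /(_ _ (club_ge c))[b [Sb cb]]; exists b => //; exact: lt_le_trans cb.
Qed.

(** If every fibre of [g] on [S] missed a club, a point [a] of [S] in the diagonal intersection
    would lie in the club attached to [g a], yet also in the fibre over [g a]. *)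
Lemma fodor (S : set omega1) (g : omega1 -> omega1) :
  stationary S -> (forall a, S a -> g a < a) ->
  exists c, stationary [set a | S a /\ g a = c].
Proof.
move=> stS gS; apply: contrapT => nc.
have /choice[C CP] : forall c, exists C, club C /\ forall a, C a -> ~ (S a /\ g a = c).
  by move=> c; apply: nonstationary_club => ?; apply: nc; exists c.
have [a0 _] := stationary_inhabited stS.
have clC c : club (C c) by case: (CP c).
have [a [Sa [_ _ /(_ _ (gS _ Sa))Ca]]] :=
  stS _ (@club_diagonal a0 _ _ (club_ge a0) clC).
by have [_ /(_ _ Ca)] := CP (g a); apply.
Qed.

(** * Recursion, cardinality and closure along [omega1] *)

Lemma omega1_recursion {T : Type} (P : set T -> T -> Prop) :
  (forall A, countable A -> exists t, P A t) ->
  exists c : omega1 -> T, forall a, P (c @` [set b | b < a]) (c a).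
Proof.
move=> exP.
have /choice[f fP] : forall A, exists t, countable A -> P A t.
  move=> A; have [/exP[t Pt]|nA] := pselect (countable A); first by exists t.
  by have [t _] := exP _ (countable0 T); exists t.
pose step a (IH : forall b : omega1, b < a -> T) :=
  f [set t | exists b (ba : b < a), t = IH b ba].
pose c := Fix omega1_wf (fun=> T) step.
have cE a : c a = f (c @` [set b | b < a]).
  rewrite {1}/c Fix_eq => [|x g h gh]; last first.
    by congr step; apply/functional_extensionality_dep => y;
      apply/functional_extensionality_dep => yx.
  congr f; apply/seteqP; split => [_ [b [ba ->]]|_ [b ba <-]]; first by exists b.
  by exists b, ba.
exists c => a; rewrite cE; apply: fP; apply: countable_image.
apply: sub_countable (omega1_initial_countable a).
by apply: subset_card_le => b; exact: ltW.
Qed.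

(* [h a] lies above all finite successors of [h b], [b < a], so that the finite
   successors of the points [h a] are a copy of [omega1 * nat] in [omega1]. *)
Lemma card_le_omega1 {X : Type} (M : omega1 -> set X) :
  (forall a, countable (M a)) -> (forall x, exists a, M a x) ->
  ([set: X] #<= [set: omega1])%card.
Proof.
move=> cM /choice[r rM].
have /choice[s sP] : forall a : omega1, exists b, a < b.
  by move=> a; have [b [ab _]] := omega1_bound2 a a; exists b.
have sn_ge n a : a <= iter n s a.
  by elim: n => //= n IH; exact: le_trans (ltW (sP _)).
have [|h hP] := @omega1_recursion omega1
    (fun A c => forall b, A b -> forall n, iter n s b < c).
  move=> A cA.
  have [|c cP] := @omega1_bound (\bigcup_(b in A) range (fun n => iter n s b)).
    apply: bigcup_countable => // b _; exact/countable_image/countableP.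
  by exists c => b Ab n; apply: cP; exists b => //; exists n.
have {}hP a b n : b < a -> iter n s (h b) < h a.
  by move=> ba; apply: hP; exists b.
have /choice[f fM] : forall a, exists f : X -> nat, {in M a &, injective f}.
  by move=> a; exact/countable_injP.
have smono a m n : (m < n)%N -> iter m s a < iter n s a.
  move=> mn; apply: (lt_le_trans (sP _)); rewrite -(subnK mn) iterD.
  exact: sn_ge.
have sinj a m n : iter m s a = iter n s a -> m = n.
  by case: (ltngtP m n) => // /(smono a) + E; rewrite E ltxx.
pose g x := iter (f (r x) x) s (h (r x)).
have ginj x y : g x = g y -> x = y.
  rewrite /g; case: (ltgtP (r x) (r y)) => [rxy|rxy|rxy].
  - move=> E; have := hP _ _ (f (r x) x) rxy.
    by rewrite E ltNge sn_ge.
  - move=> E; have := hP _ _ (f (r y) y) rxy.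
    by rewrite -E ltNge sn_ge.
  - rewrite rxy => /sinj; apply: fM; apply/mem_set; last exact: rM.
    by rewrite -rxy.
apply: card_le_trans (card_leT (range g)).
suff /card_esym : (range g #= [set: X])%card by rewrite card_eq_le => /andP[].
by apply: inj_card_eq => x y _ _; exact: ginj.
Qed.

Lemma card_le_omega1_inj {X : Type} :
  ([set: X] #<= [set: omega1])%card -> exists rho : X -> omega1, injective rho.
Proof.
move=> /card_leP[g]; exists (fun x => \val (g (SigSub (in_setT x)))).
by move=> x y /val_inj/inj; rewrite !in_setT => /(_ isT isT)[].
Qed.

(** Stage [a] applies only the operations [Phi u v c] with [c < a]; this keeps each stage countable
    although [c] ranges over all of [omega1]. *)
Inductive closure_stage (T : Type) (T0 : set T) (Phi : T -> T -> omega1 -> set T) :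
    omega1 -> T -> Prop :=
| closure_stage0 a u : T0 u -> closure_stage T0 Phi a u
| closure_stageW b a u : b < a -> closure_stage T0 Phi b u ->
    closure_stage T0 Phi a u
| closure_stageS b c a u v w : b < a -> c < a ->
    closure_stage T0 Phi b u -> closure_stage T0 Phi b v -> Phi u v c w ->
    closure_stage T0 Phi a w.

Lemma omega1_closure (T : Type) (T0 : set T) (Phi : T -> T -> omega1 -> set T) :
  countable T0 -> (forall u v c, countable (Phi u v c)) ->
  exists M : omega1 -> set T,
    [/\ forall a, countable (M a), forall u, T0 u -> exists a, M a u &
      forall u v c w, (exists a, M a u) -> (exists a, M a v) -> Phi u v c w ->
        exists a, M a w].
Proof.
move=> cT0 cPhi; exists (closure_stage T0 Phi); split.
- elim/(well_founded_ind omega1_wf) => a IH.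
  pose I := [set b | b < a].
  have cI : countable I.
    apply: sub_countable (omega1_initial_countable a).
    by apply: subset_card_le => b; exact: ltW.
  pose S := \bigcup_(b in I) closure_stage T0 Phi b.
  have cS : countable S by exact: bigcup_countable.
  pose U := \bigcup_(q in (S `*` S) `*` I) Phi q.1.1 q.1.2 q.2.
  have cU : countable U.
    by apply: bigcup_countable => //; do 2?apply: countableX.
  apply: (@sub_countable _ _ _ (T0 `|` (S `|` U))); last by do 2?apply: countable_setU.
  apply: subset_card_le => u au; case: au IH @I cI @S cS @U cU.
  + by move=> {}a {}u T0u *; left.
  + by move=> b {}a {}u ba bu *; right; left; exists b.
  + move=> b c {}a {}u v w ba ca bu bv Pw _ I cI S cS U cU; right; right.
    by exists ((u, v), c) => //; split => //; split; exists b.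
- by move=> u T0u; have [a _] := omega1_bound (countable0 omega1); exists a;
    exact: closure_stage0.
- move=> u v c w [a au] [b bv] Pw.
  have [e [ae be]] := omega1_bound2 a b; have [g [eg cg]] := omega1_bound2 e c.
  exists g; apply: (@closure_stageS _ _ _ e c g u v) => //;
    by [apply: closure_stageW au|apply: closure_stageW bv].
Qed.

(** * Retractable filtrations *)

Definition succ_in d (X : orderType d) (A : set X) (x : X) : Prop :=
  (exists a, A a /\ x < a) ->
  exists m, [/\ A m, x < m & forall a, A a -> x < a -> m <= a].

Definition pred_in d (X : orderType d) (A : set X) (x : X) : Prop :=
  (exists a, A a /\ a < x) ->
  exists m, [/\ A m, m < x & forall a, A a -> a < x -> a <= m].

(* [A] is retractable iff the restriction map from [KK X] to the final segments
   of [A] has a continuous right inverse. *)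
Definition retractable d (X : orderType d) (A : set X) : Prop :=
  forall x, ~ A x -> succ_in A x \/ pred_in A x.

Definition filtrable d (X : orderType d) : Prop :=
  exists (rho : X -> omega1) (C : set omega1),
    [/\ injective rho, club C &
        forall a, C a -> retractable [set x | rho x < a]].

Lemma filtrable_dual d (X : orderType d) : filtrable X -> filtrable X^d.
Proof.
move=> [rho [C [rinj clC CR]]]; exists rho, C; split => // a Ca x Ax.
by case: (CR a Ca x Ax) => H; [right|left].
Qed.

(** * From a filtration to the three conditions *)

Lemma club_closure_fun d (X : orderType d) (rho : X -> omega1)
    (a0 : omega1) (C0 : set omega1) (k : X -> X) :
  injective rho -> club C0 ->
  exists C, club C /\ forall a, C a ->
    [/\ a0 < a, C0 a & forall x, rho x < a -> rho (k x) < a].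
Proof.
move=> rinj clC0.
have [|C [clC CP]] :=
    @club_closure a0 C0 (fun c => [set rho (k x) | x in [set x | rho x = c]]) clC0.
  move=> c; apply: countable_image; apply/countable_injP.
  by exists (fun=> 0%N) => x y; rewrite !inE /= => <- /esym/rinj.
exists C; split => // a /CP[? ? H]; split => // x xa.
by apply: (H _ xa); exists x.
Qed.

Lemma club_closure_seq d (X : orderType d) (rho : X -> omega1)
    (C0 : set omega1) (f : omega1 -> X) :
  club C0 ->
  exists C, club C /\ forall a, C a ->
    C0 a /\ forall b, b < a -> rho (f b) < a.
Proof.
move=> clC0; have [a0 _] := omega1_bound (countable0 omega1).
have [|C [clC CP]] :=
    @club_closure a0 C0 (fun c => [set rho (f c)]) clC0.
  by move=> c; exact: countable1.
exists C; split => // a /CP[_ C0a H]; split => // b ba.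
exact: (H _ ba).
Qed.

(** Without a supremum, take [a] closed under moving an upper bound to a smaller one ([k]) and any
    other point [y] to a term [x (g y)] beyond it. Then [x a] has rank at least [a], and among the
    points of smaller rank none is nearest to it on either side. *)
Lemma filtrable_supremum d (X : orderType d) : filtrable X ->
  forall x : omega1 -> X, {homo x : a b / a <= b} ->
    has_ubound (range x) -> supremums (range x) !=set0.
Proof.
move=> [rho [C [rinj clC CR]]] x xinc [b bx]; apply: contrapT => nosup.
pose U := ubound (range x).
have xU a y : U y -> x a <= y by move=> Uy; apply: Uy; exists a.
have [a0 _] := omega1_bound (countable0 omega1).
have nU a : ~ U (x a).
  move=> Uxa; apply: nosup; exists (x a); split => // y; exact: xU.
have /choice[k kP] : forall y, exists z, U y -> U z /\ z < y.
  move=> y; have [Uy|nUy] := pselect (U y); last by exists y.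
  apply: contrapT => nz; apply: nosup; exists y; split => // z Uz.
  by rewrite leNgt; apply/negP => zy; apply: nz; exists z.
have /choice[g gP] : forall y, exists a, ~ U y -> y < x a.
  move=> y; have [Uy|nUy] := pselect (U y); first by exists a0.
  apply: contrapT => nz; apply: nUy => _ [a _ <-].
  by rewrite leNgt; apply/negP => yx; apply: nz; exists a.
have [C1 [clC1 C1P]] := club_closure_fun (rho b) k rinj clC.
have [C2 [clC2 C2P]] := club_closure_fun (rho (x a0)) (fun y => x (g y)) rinj clC1.
have [|C3 [clC3 C3P]] := @club_closure a0 C2
    (fun c => [set g y | y in [set y | rho y = c]]) clC2.
  move=> c; apply: countable_image; apply/countable_injP.
  by exists (fun=> 0%N) => u v; rewrite !inE /= => <- /esym/rinj.
have [a /C3P[_ /C2P[x0a /C1P[ba Ca ka] xga] ga] _] := clC3.2 a0.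
have below y : rho y < a -> ~ U y -> y < x a.
  move=> ya nUy; apply: (lt_le_trans (gP _ nUy)); apply/xinc/ltW.
  by apply: (ga _ ya); exists y.
have above y : U y -> x a < y.
  move=> Uy; rewrite lt_neqAle xU // andbT; apply/eqP => E.
  by apply: (nU a); rewrite E.
have nA : ~ rho (x a) < a by move=> /below /(_ (@nU a)); rewrite ltxx.
case: (CR a Ca (x a) nA).
  case; first by exists b; split => //; exact: above.
  move=> m [/= ma am mmin]; have [Um|nUm] := pselect (U m).
    have [Uk kl] := kP _ Um.
    by have := mmin _ (ka _ ma) (above _ Uk); rewrite leNgt kl.
  by have := below _ ma nUm; rewrite ltNge (ltW am).
case; first by exists (x a0); split => //; exact: below.
move=> m [/= ma am mmin].
have nUm : ~ U m by move=> /above; rewrite ltNge (ltW am).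
have := mmin _ (xga _ ma) (below _ (xga _ ma) (@nU _)).
by rewrite leNgt gP.
Qed.

(** Fodor's lemma freezes the nearest point [m a] of smaller rank below [f a]. If [f a < f b] with
    [a < b], then [f a] has rank below [b], so [f a <= m b = m a < f a]. Where no point of smaller
    rank lies below, [f a] would be one for [f b]. *)
Lemma stationary_decreasing d (X : orderType d) (rho : X -> omega1)
    (S : set omega1) (f : omega1 -> X) :
  injective rho -> stationary S ->
  (forall a, S a -> ~ rho (f a) < a /\ pred_in [set x | rho x < a] (f a)) ->
  exists T, [/\ stationary T, T `<=` S &
    forall a b, T a -> T b -> a <= b -> f b <= f a].
Proof.
move=> rinj stS SP.
have [a0 _] := stationary_inhabited stS.
have [C [clC CP]] := club_closure_seq rho f (club_ge a0).
pose E := [set a | S a /\ exists y, rho y < a /\ y < f a].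
pose N := [set a | S a /\ ~ exists y, rho y < a /\ y < f a].
have : stationary (E `|` N).
  apply: stationaryS stS => a Sa.
  by have [?|?] := pselect (exists y, rho y < a /\ y < f a); [left|right].
case/stationaryU => [stE|stN].
- have /choice[m mP] : forall a, exists m, E a ->
      [/\ rho m < a, m < f a & forall y, rho y < a -> y < f a -> y <= m].
    move=> a; have [Ea|nEa] := pselect (E a); last by exists (f a).
    have [Sa ey] := Ea; have [_ /(_ ey)[m [? ? mP]]] := SP _ Sa.
    by exists m => _; split.
  have [|c stc] := @fodor E (rho \o m) stE; first by move=> a /mP[].
  have stT := stationaryI stc clC.
  exists ([set a | E a /\ rho (m a) = c] `&` C); split => //.
    by move=> a [[[Sa _] _] _].
  move=> a b [[Ea ma] Ca] [[Eb mb] Cb].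
  rewrite le_eqVlt => /orP[/eqP->//|ab]; rewrite leNgt; apply/negP => fab.
  have mab : m a = m b by apply: rinj; rewrite ma mb.
  have [_ mfa _] := mP _ Ea; have [_ _ mbP] := mP _ Eb.
  have [_ Cb'] := CP _ Cb.
  by have := mbP _ (Cb' _ ab) fab; rewrite -mab leNgt mfa.
- exists (N `&` C); split; first exact: stationaryI.
    by move=> a [[]].
  move=> a b [[Sa _] Ca] [[Sb nb] Cb].
  rewrite le_eqVlt => /orP[/eqP->//|ab]; rewrite leNgt; apply/negP => fab.
  have [_ Cb'] := CP _ Cb.
  by apply: nb; exists (f a); split => //; exact: Cb'.
Qed.

(** Stationarily often either [f a] has rank below [a], and Fodor's lemma makes [f] constant, or
    [succ_in] holds, giving an increasing restriction, or [pred_in], giving a decreasing one. *)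
Lemma filtrable_monotone d (X : orderType d) (S : set omega1) (f : omega1 -> X) :
  filtrable X -> stationary S ->
  exists T, [/\ stationary T, T `<=` S &
    (forall a b, T a -> T b -> a <= b -> f a <= f b) \/
    (forall a b, T a -> T b -> a <= b -> f b <= f a)].
Proof.
move=> [rho [C [rinj clC CR]]] stS.
pose P := [set a | S a /\ rho (f a) < a].
pose Q := [set a | S a /\ (~ rho (f a) < a /\ succ_in [set x | rho x < a] (f a))].
pose Q' := [set a | S a /\ (~ rho (f a) < a /\ pred_in [set x | rho x < a] (f a))].
have : stationary (P `|` (Q `|` Q')).
  apply: stationaryS (stationaryI stS clC) => a [Sa Ca].
  have [fa|nfa] := pselect (rho (f a) < a); first by left.
  by right; have [?|?] := CR a Ca _ nfa; [left|right].
case/stationaryU => [stP|/stationaryU[stQ|stQ']].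
- have [|c stc] := @fodor P (rho \o f) stP; first by move=> a [].
  exists [set a | P a /\ rho (f a) = c]; split => //; first by move=> a [[]].
  by left => a b [_ fa] [_ fb] _; rewrite (_ : f a = f b)//; apply: rinj; rewrite fa.
- have [|T [stT TQ TP]] := @stationary_decreasing _ X^d rho Q f rinj stQ.
    by move=> a [].
  exists T; split => //; first by move=> a /TQ[].
  by left => a b Ta Tb; exact: (TP a b Ta Tb).
- have [|T [stT TQ TP]] := stationary_decreasing (f := f) rinj stQ'.
    by move=> a [].
  exists T; split => //; first by move=> a /TQ[].
  by right => a b Ta Tb; exact: (TP a b Ta Tb).
Qed.

(** * From the three conditions to a filtration *)

Lemma no_increasing_unretractable d (X : orderType d) (rho : X -> omega1)
    (T : set omega1) (f : omega1 -> X) :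
  injective rho ->
  (forall x : omega1 -> X, {homo x : a b / a <= b} ->
     has_ubound (range x) -> supremums (range x) !=set0) ->
  stationary T ->
  (forall a, T a -> ~ rho (f a) < a /\ ~ succ_in [set x | rho x < a] (f a)) ->
  (forall a b, T a -> T b -> a <= b -> f a <= f b) -> False.
Proof.
move=> rinj sups stT TP Tinc.
have /choice[t tP] : forall a, exists b, [/\ T b, a <= b &
    forall c, T c -> a <= c -> b <= c].
  move=> a; have [b Tb ab] := stationary_gt a stT.
  have [|c [Tc ac] cmin] := @omega1_minimum [set b | T b /\ a <= b].
    by exists b; split => //; exact: ltW.
  by exists c; split => // e Te ae; exact: cmin.
(* Passing to the next element of [T] turns [f] on [T] into a sequence indexed by all of
   [omega1]. *)
pose x a := f (t a).
have xinc : {homo x : a b / a <= b}.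
  move=> a b ab; have [Ta ta amin] := tP a; have [Tb tb bmin] := tP b.
  by apply: Tinc => //; apply: amin => //; exact: le_trans tb.
have fx a : T a -> f a = x a.
  move=> Ta; have [Tta ta amin] := tP a; congr f.
  by apply/eqP; rewrite eq_le ta /=; exact: amin.
have ubx (S : set omega1) y : stationary S -> (forall a, S a -> T a /\ f a <= y) ->
    ubound (range x) y.
  move=> stS SP _ [a _ <-]; have [b Sb ab] := stationary_gt a stS.
  have [Tb fb] := SP _ Sb; apply: le_trans fb; rewrite fx //.
  by apply: xinc; exact: ltW.
(* By Fodor's lemma a choice of [g a >= f a] of rank below [a] is constant on a stationary set, and
   its value there bounds the whole sequence. Points above [f a] thus yield a bound, hence a
   supremum [s]; points between [f a] and [s] then yield an upper bound below [s]. *)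
have key (S : set omega1) (g : omega1 -> X) : stationary S ->
    (forall a, S a -> T a /\ rho (g a) < a /\ f a <= g a) ->
    exists y, [/\ ubound (range x) y & exists2 a, S a & g a = y].
  move=> stS SP; have [|c stc] := @fodor S (rho \o g) stS.
    by move=> a /SP[_ []].
  have [a [Sa ga]] := stationary_inhabited stc; exists (g a); split; last first.
    by exists a.
  apply: (ubx _ _ stc) => b [/SP[Tb [_ fb]] gb]; split => //.
  by rewrite (rinj (g a) (g b)) //; exact: etrans ga (esym gb).
have [s [sub slb]] : supremums (range x) !=set0.
  apply: sups => //.
  have /choice[g gP] : forall a, exists y, T a -> rho y < a /\ f a < y.
    move=> a; have [Ta|nTa] := pselect (T a); last by exists (f a).
    apply: contrapT => ny; have [_] := TP _ Ta; apply => -[y yP]; exfalso.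
    by apply: ny; exists y.
  have [a /[dup] Ta /gP[ga /ltW fa]//|y [uby _]] := key T g stT.
  by exists y.
have /choice[g gP] : forall a, exists y, T a -> rho s < a ->
    [/\ rho y < a, f a < y & y < s].
  move=> a; have [Ta|nTa] := pselect (T a); last by exists (f a).
  have [sa|nsa] := pselect (rho s < a); last by exists (f a).
  have [nfa nsucc] := TP _ Ta.
  have fas : f a < s.
    rewrite lt_neqAle; apply/andP; split.
      by apply/eqP => E; apply: nfa; rewrite E.
    by rewrite fx //; apply: sub; exists a.
  (* With no such [y], [s] would be the nearest point above [f a]. *)
  apply: contrapT => ny; apply: nsucc => _; exists s; split => // y ya fay.
  by rewrite leNgt; apply/negP => ys; apply: ny; exists y.
have [c [sc _]] := omega1_bound2 (rho s) (rho s).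
have [a [Ta ca]|y [uby [a [Ta ca] gay]]] := key _ g (stationaryI stT (club_ge c)).
  by have [? /ltW ? _] := gP _ Ta (lt_le_trans sc ca).
have [_ _] := gP _ Ta (lt_le_trans sc ca).
by rewrite gay ltNge (slb _ uby).
Qed.

(** For any injective rank the levels that are not retractable are nonstationary: otherwise a choice
    of two-sided gaps [f a] would be monotone on a stationary set, which the preceding lemma
    excludes for [X] and for its dual. *)
Lemma monotone_filtrable d (X : orderType d) :
  ([set: X] #<= [set: omega1])%card ->
  (forall x : omega1 -> X, {homo x : a b / a <= b} ->
     has_ubound (range x) -> supremums (range x) !=set0) ->
  (forall x : omega1 -> X, {homo x : a b / a <= b >-> b <= a} ->
     has_lbound (range x) -> infimums (range x) !=set0) ->
  (forall (S : set omega1) (f : omega1 -> X), stationary S ->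
     exists T, [/\ stationary T, T `<=` S &
      (forall a b, T a -> T b -> a <= b -> f a <= f b) \/
      (forall a b, T a -> T b -> a <= b -> f b <= f a)]) ->
  filtrable X.
Proof.
move=> /card_le_omega1_inj[rho rinj] sups infs mono.
pose S := [set a | ~ retractable [set x | rho x < a]].
have [stS|/nonstationary_club[C [clC CS]]] := pselect (stationary S); last first.
  by exists rho, C; split => // a /CS/contrapT.
exfalso.
have [a0 Sa0] := stationary_inhabited stS.
have ex a : S a -> exists x, ~ rho x < a /\
    (~ succ_in [set x | rho x < a] x /\ ~ pred_in [set x | rho x < a] x).
  move=> Sa; apply: contrapT => nx; apply: Sa => x xa.
  by apply: contrapT => /not_orP[? ?]; apply: nx; exists x.
have [x0 _] := ex _ Sa0.
have /choice[f fP] : forall a, exists x, S a -> ~ rho x < a /\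
    (~ succ_in [set x | rho x < a] x /\ ~ pred_in [set x | rho x < a] x).
  move=> a; have [/ex[x xP]|nSa] := pselect (S a); first by exists x.
  by exists x0.
have [T [stT TS [Tinc|Tdec]]] := mono S f stS.
- apply: (no_increasing_unretractable rinj sups stT _ Tinc).
  by move=> a /TS/fP[? []].
- apply: (@no_increasing_unretractable _ X^d rho T f rinj infs stT _ Tdec).
  by move=> a /TS/fP[? []].
Qed.

Lemma filtrableP d (X : orderType d) : filtrable X <->
  [/\ ([set: X] #<= [set: omega1])%card,
      (forall x : omega1 -> X, {homo x : a b / a <= b} ->
         has_ubound (range x) -> supremums (range x) !=set0) /\
      (forall x : omega1 -> X, {homo x : a b / a <= b >-> b <= a} ->
         has_lbound (range x) -> infimums (range x) !=set0)
    & forall (S : set omega1) (f : S -> X), stationary S ->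
        exists T : set omega1,
          [/\ stationary T, T `<=` S
            & (forall a b : S, T (\val a) -> T (\val b) ->
                 \val a <= \val b -> f a <= f b) \/
              (forall a b : S, T (\val a) -> T (\val b) ->
                 \val a <= \val b -> f b <= f a)]].
Proof.
split=> [fX|[cX [sups infs] mono]]; last first.
  apply: monotone_filtrable => // S f stS.
  have [T [stT TS TP]] := mono S (fun a => f (\val a)) stS.
  exists T; split => //; case: TP => TP; [left|right] => a b Ta Tb ab;
    exact: (TP (SigSub (mem_set (TS _ Ta))) (SigSub (mem_set (TS _ Tb)))).
split.
- have [rho [C [rinj _ _]]] := fX.
  apply: (@card_le_omega1 _ (fun a => [set x | rho x = a])) => [a|x]; last first.
    by exists (rho x).
  apply/countable_injP; exists (fun=> 0%N) => x y.
  by rewrite !inE /= => <- /esym/rinj.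
- split; first exact: filtrable_supremum.
  exact: (@filtrable_supremum _ X^d (filtrable_dual fX)).
- move=> S f stS; have [a0 Sa0] := stationary_inhabited stS.
  pose g a := if pselect (S a) is left Sa then f (SigSub (mem_set Sa))
    else f (SigSub (mem_set Sa0)).
  have gE (a : S) : f a = g (\val a).
    rewrite /g; case: pselect => [Sa|]; last by have := set_valP a.
    by congr f; apply: val_inj.
  have [T [stT TS TP]] := filtrable_monotone g fX stS.
  exists T; split => //; case: TP => TP; [left|right] => a b Ta Tb ab;
    by rewrite !gE; exact: TP.
Qed.

(** * From a filtration to a Valdivia embedding *)

Lemma cvg_initial (S : choiceType) (T : topologicalType) (f : S -> T)
    (F : set_system S) (s : S) :
  Filter F -> f @ F --> f s -> F --> (s : initial_topology f).
Proof.
move=> FF Ffs A [B [[C oC <-] Cfs sCA]]; apply: filterS sCA _.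
by apply: Ffs; exact: open_nbhs_nbhs.
Qed.

Lemma cvg_ptws_sub (I T : Type) (K : topologicalType)
    (S : set {ptws I -> K}) (F : set_system T) (u : T -> S) (s : S) :
  Filter F -> (forall i, (fun t => \val (u t) i) @ F --> \val s i) ->
  u @ F --> s.
Proof.
move=> FF H.
apply: (@cvg_initial _ _ (set_val : S -> {ptws I -> K}) (u @ F) s).
by apply/cvg_sup => i; apply: cvg_initial; exact: (H i).
Qed.

Lemma ptws_sub_coord_continuous (I : Type) (K : topologicalType) (S : set {ptws I -> K})
  (i : I) : continuous (fun s : S => \val s i).
Proof.
move=> s; apply: (@continuous_comp _ _ _ (set_val : S -> {ptws I -> K})
  (fun f : {ptws I -> K} => f i)); first exact: initial_continuous.
have /cvg_sup/(_ i) H : nbhs (\val s : {ptws I -> K}) --> (\val s : {ptws I -> K}).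
  exact: cvg_id.
apply: (cvg_trans _ (@initial_continuous _ _ (fun f : I -> K => f i) (\val s))).
exact: cvg_app.
Qed.

Lemma coord_near (I : Type) (S : set {ptws I -> bool}) (s : S) (i : I) :
  \forall t \near s, \val t i = \val s i.
Proof.
by apply: (@ptws_sub_coord_continuous _ _ S i s [set b | b = \val s i]);
  exact: discrete_set1.
Qed.

(** An ultrafilter decides every coordinate; the values it decides form a final segment, to which it
    converges coordinatewise. *)
Lemma KK_compact d (X : orderType d) : compact [set: KK X].
Proof.
rewrite compact_ultra => F FU _.
pose s x := `[< F [set t : KK X | \val t x] >].
have sK : KK X s.
  move=> x y xy /asboolP Fx; apply/asboolP; apply: filterS Fx => t /=.
  by apply: (set_mem (valP t)).
exists (SigSub (mem_set sK)); split => //.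
apply: (@cvg_ptws_sub _ _ _ _ _ id) => x; apply: cvg_near_cst.
have [Fx|] := in_ultra_setVsetC [set t : KK X | \val t x] FU.
  apply: filterS (Fx) => t /= tx; rewrite tx; exact/esym/asboolP.
move=> /[dup] Fx; apply: filterS => t /= /negP/negbTE ->; apply/esym/asboolPn.
move=> Fx'; by have [w []] := filter_ex (filterI Fx Fx').
Qed.

(** The new rank of [x] is the last element of [C] up to [rho x], so that an attained rank in [C]
    has the same sublevel set for [r] as for [rho]. Points before the first element of [C] get the
    least ordinal [z], whose sublevel set is empty. *)
Lemma filtrable_rank d (X : orderType d) : filtrable X ->
  exists r : X -> omega1, (forall a, countable [set x | r x < a]) /\
    forall a, (exists x, r x = a) -> retractable [set x | r x < a].
Proof.
move=> [rho [C [rinj clC CR]]].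
have [a0 _] := omega1_bound (countable0 omega1).
have [z _ zmin] := @omega1_minimum [set: omega1] (ex_intro _ a0 I).
have /choice[t tP] : forall a, exists c, [/\ (C `|` [set z]) c, c <= a &
    forall e, C e -> e <= a -> e <= c].
  move=> a.
  have [|s sub smin] := @omega1_minimum [set s | forall e, C e -> e <= a -> e <= s].
    by exists a.
  have sa : s <= a by apply: smin.
  have [Ce|nCe] := pselect (exists2 c, C c & c <= a); last first.
    exists z; split => //; [by right|exact: zmin|].
    by move=> e Ce ea; exfalso; apply: nCe; exists e.
  exists s; split => //; left; case: clC => clC _.
  apply: (closed_limit clC); first by case: Ce => c Cc ca; exists c => //; exact: sub.
  move=> b bs; apply: contrapT => nc.
  suff : s <= b by rewrite leNgt bs.
  apply: smin => e Ce' ea; rewrite leNgt; apply/negP => be.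
  by apply: nc; exists e; split => //; exact: sub.
exists (t \o rho); split.
  move=> a; have [c Cc ac] := clC.2 a.
  apply: (@sub_countable _ _ _ (rho @^-1` [set b | b <= c])).
    apply: subset_card_le => x /= ta; rewrite leNgt; apply/negP => cx.
    have [_ _ /(_ _ Cc (ltW cx))] := tP (rho x).
    by rewrite leNgt (lt_trans ta ac).
  apply: sub_countable (omega1_initial_countable c).
  by apply: card_ge_preimage => x y _ _ /rinj.
move=> _ [x0 <-]; have [[Ca|az] _ _] := tP (rho x0).
  rewrite (_ : [set x | _] = [set x | rho x < t (rho x0)]); first exact: CR.
  apply/seteqP; split=> x /=; last by apply: le_lt_trans; case: (tP (rho x)).
  move=> tx; rewrite ltNge; apply/negP => ax.
  have [_ _ /(_ _ Ca ax)] := tP (rho x).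
  by rewrite leNgt tx.
move=> x _; left => -[y [yz _]]; exfalso.
have : t (rho y) < z by rewrite -az.
by rewrite ltNge zmin.
Qed.

(* The cut of a point [x] in [A] is given by [U], the points of [A] above [x],
   and [L], those below it; the parent is the nearest point of [A], from above
   whenever possible, [inr true] and [inr false] being formal endpoints. *)
Definition cut_parent d (X : orderType d) (U L : set X) : X + bool :=
  if pselect (exists m, U m /\ forall a, U a -> m <= a) is left e
  then inl (sval (cid e))
  else if pselect (exists a, U a) is right _ then inr true
  else if pselect (exists m, L m /\ forall a, L a -> a <= m) is left e
  then inl (sval (cid e))
  else inr false.

Definition eval_end (X : Type) (F : X -> bool) (u : X + bool) : bool :=
  match u with inl x => F x | inr b => b end.

Definition final_on d (X : orderType d) (A : set X) (F : X -> bool) : Prop :=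
  forall x y, A x -> A y -> x <= y -> F x -> F y.

Lemma cut_parent_mem d (X : orderType d) (U L : set X) y :
  cut_parent U L = inl y -> U y \/ L y.
Proof.
rewrite /cut_parent; case: pselect => [e|_].
  by case: cid => m [Um _] /= [<-]; left.
case: pselect => // _; case: pselect => [e|//].
by case: cid => m [Um _] /= [<-]; right.
Qed.

Lemma cut_parentP d (X : orderType d) (A : set X) (F : X -> bool) (x : X) :
  final_on A F -> succ_in A x \/ pred_in A x ->
  let u := cut_parent (A `&` [set a | x < a]) (A `&` [set a | a < x]) in
  (forall a, A a -> a < x -> F a -> eval_end F u) /\
  (forall a, A a -> x < a -> eval_end F u -> F a).
Proof.
move=> AF Ax /=; rewrite /cut_parent; case: pselect => [e|nm].
  case: cid => m [[Am xm] mP] /=; split=> a Aa ax.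
    by apply: AF => //; exact/ltW/(lt_trans ax).
  by apply: AF => //; exact: mP.
case: pselect => [eU|nU] /=; last first.
  by split=> // a Aa xa; exfalso; apply: nU; exists a.
have predx : pred_in A x.
  case: Ax => // sx; exfalso; apply: nm.
  have [|m [Am xm mP]] := sx; first by case: eU => a [? ?]; exists a.
  by exists m; split => // a [Aa xa]; exact: mP.
case: pselect => [e|nL].
  case: cid => m [[Am xm] mP] /=; split=> a Aa ax.
    by apply: AF => //; exact: mP.
  by apply: AF => //; exact/ltW/(lt_trans xm).
split=> // a Aa ax _; exfalso; apply: nL.
have [|m [Am xm mP]] := predx; first by exists a.
by exists m; split => // b [Ab bx]; exact: mP.
Qed.

Definition extend_once d (X : orderType d) (r : X -> omega1) (p : X -> X + bool)
    (m : omega1) (F : X -> bool) (x : X) : bool :=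
  if r x < m then F x else eval_end F (p x).

(** All points of rank [m] see the same set of points of smaller rank. Two of them are either
    separated by such a point, through which their values compare, or lie in the same cut and share
    a parent, as [cut_parent] depends on the cut only. *)
Lemma rank_parent d (X : orderType d) (r : X -> omega1) :
  (forall a, (exists x, r x = a) -> retractable [set x | r x < a]) ->
  exists p : X -> X + bool,
    (forall x y, p x = inl y -> r y < r x) /\
    (forall m F, final_on [set x | r x < m] F ->
       final_on [set x | r x <= m] (extend_once r p m F)).
Proof.
move=> rR; pose A x := [set y | r y < r x].
pose p x := cut_parent (A x `&` [set a | x < a]) (A x `&` [set a | a < x]).
exists p; split; first by move=> x y /cut_parent_mem[] [].
move=> m F Fm x y /= xm ym; rewrite le_eqVlt => /orP[/eqP->//|xy].
have nA z : r z = m -> ~ A z z by rewrite /A /= ltxx.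
have par z : r z = m -> (forall a, r a < m -> a < z -> F a -> eval_end F (p z)) /\
    (forall a, r a < m -> z < a -> eval_end F (p z) -> F a).
  move=> zm; have := @cut_parentP _ _ (A z) F z; rewrite -zm; apply.
    by rewrite /A zm.
  by apply: rR; [exists z|rewrite /= ltxx].
rewrite /extend_once; case: ltP => xm'; case: ltP => ym'.
- by apply: Fm => //; exact: ltW.
- have [|+ _] := par y; first by apply/eqP; rewrite eq_le ym ym'.
  exact.
- have [|_ +] := par x; first by apply/eqP; rewrite eq_le xm xm'.
  exact.
- have Ex : r x = m by apply/eqP; rewrite eq_le xm xm'.
  have Ey : r y = m by apply/eqP; rewrite eq_le ym ym'.
  have [[a [am xa ay]]|na] := pselect (exists a, [/\ r a < m, x < a & a < y]).
    move=> px; have [+ _] := par y Ey; apply; [exact: am|exact: ay|].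
    by have [_ +] := par x Ex; apply; [exact: am|exact: xa|].
  rewrite (_ : p x = p y)// /p /A Ex Ey; congr cut_parent; apply/seteqP; split=> a /=.
  + move=> [am xa]; split => //; rewrite ltNge le_eqVlt; apply/negP.
    by case/orP => [/eqP E|ay]; [move: am; rewrite E Ey ltxx|apply: na; exists a].
  + by move=> [am ya]; split => //; exact: lt_trans ya.
  + by move=> [am ya]; split => //; exact: lt_trans xy.
  + move=> [am ya]; split => //; rewrite ltNge le_eqVlt; apply/negP.
    by case/orP => [/eqP E|xa]; [move: am; rewrite -E Ex ltxx|apply: na; exists a].
Qed.

(** When parents have smaller rank, following them down from [x] ends at a point of rank below [a],
    where [F] decides, or at a formal endpoint. *)
Inductive extension (X : Type) (r : X -> omega1) (p : X -> X + bool)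
    (F : X -> bool) (a : omega1) : X -> Prop :=
| extension_base x : r x < a -> F x -> extension r p F a x
| extension_end x : a <= r x -> p x = inr true -> extension r p F a x
| extension_step x y : a <= r x -> p x = inl y -> extension r p F a y ->
    extension r p F a x.

Lemma extension_exists d (X : orderType d) (r : X -> omega1) (p : X -> X + bool)
    (F : X -> bool) (a : omega1) :
  (forall x y, p x = inl y -> r y < r x) ->
  (forall m F, final_on [set x | r x < m] F ->
     final_on [set x | r x <= m] (extend_once r p m F)) ->
  final_segment F ->
  exists G, [/\ final_segment G, forall x, r x < a -> G x = F x &
    forall x, a <= r x -> G x = eval_end G (p x)].
Proof.
move=> pr pF Ffin; pose G x := `[< extension r p F a x >].
have extP x : extension r p F a x -> (r x < a /\ F x) \/
    (a <= r x /\ (p x = inr true \/ exists y, p x = inl y /\ extension r p F a y)).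
  by case=> [{}x|{}x|{}x y] *; [left|right..]; split => //; [left|right; exists y].
have Gbase x : r x < a -> G x = F x.
  move=> xa; apply/asboolP/idP => [|Fx]; last exact: extension_base.
  by case/extP => [[]//|[]]; rewrite leNgt xa.
have Gstep x : a <= r x -> G x = eval_end G (p x).
  move=> ax; apply/asboolP/idP => [/extP|].
    case=> [[]|[_ [->//|[y [-> ?]]]]]; first by rewrite ltNge ax.
    exact/asboolP.
  case E : (p x) => [y|[]]//=; last by move=> _; exact: extension_end.
  by move=> /asboolP; exact: extension_step.
exists G; split => //.
have Gfin m : final_on [set x | r x < m] G.
  elim/(well_founded_ind omega1_wf) : m => m IH x y /= xm ym.
  (* Only two points are compared at a time, so their larger rank [n] replaces [m] and limit stages
     need no separate treatment. *)
  have [n [nm [rxn ryn]]] : exists n, n < m /\ r x <= n /\ r y <= n.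
    by exists (Order.max (r x) (r y)); rewrite gt_max xm ym !le_max !lexx orbT.
  move=> xy; case: (leP a n) => an; last first.
    by rewrite !Gbase; [exact: Ffin| |]; exact: le_lt_trans an.
  have GE z : r z <= n -> extend_once r p n G z = G z.
    rewrite /extend_once; case: ltP => // nz zn; rewrite Gstep //.
    exact: le_trans nz.
  by have := pF n G (IH n nm) x y rxn ryn xy; rewrite !GE.
move=> x y xy; have [m [xm ym]] := omega1_bound2 (r x) (r y).
exact: (Gfin m).
Qed.

Lemma natr_bool_near (R : realType) (b c : bool) :
  (`|b%:R - c%:R| < 1 :> R)%R -> b = c.
Proof.
by case: b c => [] [] //; rewrite ?subr0 ?sub0r ?normrN normr1 ltxx.
Qed.

(* [F] is sent to the indicator of the points where it differs from its value at
   the parent; it is constant along parents beyond rank [a] iff this indicator is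
   supported on the countable set of points of rank below [a]. *)
Lemma filtrable_valdivia (R : realType) d (X : orderType d) :
  filtrable X -> valdivia R (KK X).
Proof.
move=> /filtrable_rank[r [rc /rank_parent[p [pr pF]]]].
split; first exact: KK_compact.
pose bit (F : X -> bool) x := F x (+) eval_end F (p x).
pose phi (F : X -> bool) : {ptws X -> R} := fun x => (bit F x)%:R%R.
have ind (P : X -> Prop) : (forall x, (forall y, p x = inl y -> P y) -> P x) ->
    forall x, P x.
  move=> IH x; move E : (r x) => a; move: x E.
  elim/(well_founded_ind omega1_wf) : a => a IHa x rx; apply: IH => y /pr.
  by rewrite rx => ya; exact: (IHa _ ya).
have phiE (F G : X -> bool) : phi F = phi G -> F = G.
  move=> FG; apply/funext; apply: ind => x IH.
  have : bit F x = bit G x.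
    apply: (@natr_bool_near R); rewrite -[X in (X - _)%R]/(phi F x) FG.
    by rewrite subrr normr0 ltr01.
  rewrite /bit (_ : eval_end F (p x) = eval_end G (p x)); last first.
    by case E : (p x) => [y|b] //=; exact: IH.
  exact: addIb.
pose K' : set {ptws X -> R} := [set phi (\val F) | F in [set: KK X]].
have K'phi (F : KK X) : K' (phi (\val F)) by exists F.
have /choice[g gP] : forall k : K', exists F : KK X, phi (\val F) = \val k.
  by move=> k; have [F _ ?] := set_mem (valP k); exists F.
pose f (F : KK X) : K' := SigSub (mem_set (K'phi F)).
have fc : continuous f.
  move=> F; apply: (@cvg_ptws_sub _ _ R K' (nbhs F) f) => x; apply: cvg_near_cst.
  near=> G.
  have E1 : \val G x = \val F x by near: G; exact: coord_near.
  have E2 : eval_end (\val G) (p x) = eval_end (\val F) (p x).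
    by near: G; case: (p x) => [y|b]; [exact: coord_near|exact: nearW].
  by rewrite /= /phi /bit E1 E2.
exists X, K'; split.
  exists f, g; split => //.
  - by move=> F; apply/val_inj/phiE; rewrite gP.
  - by move=> k; apply/val_inj; rewrite /= gP.
  (* Near [k] the bit at [x] is constant, and by induction so is the value at the parent; together
     they determine the value at [x]. *)
  - move=> k; apply: (@cvg_ptws_sub _ _ bool (KK X) (nbhs k) g) => x; apply: cvg_near_cst.
    move: x; apply: ind => x IH.
    have bitE : \forall k' \near k, bit (\val (g k')) x = bit (\val (g k)) x.
      have := @ptws_sub_coord_continuous _ R K' x k.
      move=> /cvgrPdist_lt /(_ 1%R ltr01).
      apply: filterS => k' H.
      by apply/esym/(@natr_bool_near R); move: H; rewrite -!gP.
    have evE : \forall k' \near k,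
        eval_end (\val (g k')) (p x) = eval_end (\val (g k)) (p x).
      by case E : (p x) => [y|b]; [exact: IH|by near=> k'].
    near=> k'.
    have E1 : bit (\val (g k')) x = bit (\val (g k)) x by near: k'.
    have E2 : eval_end (\val (g k')) (p x) = eval_end (\val (g k)) (p x).
      by near: k'.
    by move: E1; rewrite /bit E2 => /addIb.
move=> O [k Ok] oO.
have [F Ffin] : exists F, F = g k by exists (g k).
(* [G a] follows [F] on points of rank below [a] and parents from there on: its image has countable
   support, and [G a] tends to [F] as [a] grows. *)
have /choice[G GP] : forall a, exists G : KK X,
    (forall x, r x < a -> \val G x = \val F x) /\
    forall x, a <= r x -> \val G x = eval_end (\val G) (p x).
  move=> a; have [G [Gfin G1 G2]] := extension_exists a pr pF (set_mem (valP F)).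
  by exists (SigSub (mem_set Gfin)).
pose tails : set_system omega1 :=
  filter_from [set: omega1] (fun a => [set b | a <= b]).
have tailsF : Filter tails.
  apply: filter_from_filter; first by have [a _] := omega1_bound (countable0 omega1); exists a.
  move=> a b _ _; exists (Order.max a b) => // c /=.
  by rewrite ge_max => /andP[].
have GF : G @ tails --> F.
  apply: (@cvg_ptws_sub _ _ bool (KK X)) => x; apply: cvg_near_cst.
  have [c [xc _]] := omega1_bound2 (r x) (r x); exists c => // b /= cb.
  by have [-> //] := GP b; exact: lt_le_trans cb.
have fGO : (f \o G) @ tails --> k.
  have -> : k = f F by apply/val_inj; rewrite /= Ffin gP.
  exact: (cvg_comp _ _ GF (fc F)).
have [a _ /(_ a (lexx _)) fGa] := fGO O (open_nbhs_nbhs (conj oO Ok)).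
exists (f (G a)); split => //=.
apply: sub_countable (rc a); apply: subset_card_le => x /=.
apply: contraNT; rewrite -leNgt /phi /bit => ax.
by have [_ <-] := GP a; rewrite ?addbb.
Unshelve. all: by end_near.
Qed.

(** * From a Valdivia embedding to a filtration *)

Definition between (X : Type) (F : X -> bool) (q : (X + bool) * (X + bool)) : bool :=
  ~~ eval_end F q.1 && eval_end F q.2.

Lemma end_max d (X : orderType d) (F : X -> bool) (u u' : X + bool) :
  ~~ eval_end F u -> ~~ eval_end F u' ->
  exists2 w, ~~ eval_end F w &
    forall G, final_segment G -> ~~ eval_end G w ->
      ~~ eval_end G u && ~~ eval_end G u'.
Proof.
case: u u' => [x|[]]// [x'|[]]//= nx nx'.
- exists (inl (Order.max x x')); first by rewrite /= maxEle; case: ifP.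
  move=> G Gfin /= nG; apply/andP; split; apply: contra nG; apply: Gfin;
    by rewrite le_max lexx ?orbT.
- by exists (inl x) => // G _ /= ->.
- by exists (inl x') => // G _ /= ->.
- by exists (inr false).
Qed.

Lemma end_min d (X : orderType d) (F : X -> bool) (u u' : X + bool) :
  eval_end F u -> eval_end F u' ->
  exists2 w, eval_end F w &
    forall G, final_segment G -> eval_end G w -> eval_end G u && eval_end G u'.
Proof.
case: u u' => [x|[]]// [x'|[]]//= nx nx'.
- exists (inl (Order.min x x')); first by rewrite /= minEle; case: ifP.
  move=> G Gfin /= nG; apply/andP; split; apply: Gfin nG;
    by rewrite ge_min lexx ?orbT.
- by exists (inl x) => // G _ /= ->.
- by exists (inl x') => // G _ /= ->.
- by exists (inr true).
Qed.

Lemma between_near d (X : orderType d) (F : KK X) q :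
  between (\val F) q -> \forall G \near F, between (\val G) q.
Proof.
move=> Fq; have evn u : \forall G \near F, eval_end (\val G) u = eval_end (\val F) u.
  by case: u => [x|b]; [exact: coord_near|by near=> G].
near=> G; have E1 : eval_end (\val G) q.1 = eval_end (\val F) q.1 by near: G; exact: evn.
have E2 : eval_end (\val G) q.2 = eval_end (\val F) q.2 by near: G; exact: evn.
by rewrite /between E1 E2.
Unshelve. all: by end_near.
Qed.

Lemma between_nbhs d (X : orderType d) (F : KK X) (U : set (KK X)) :
  nbhs F U -> exists2 q, between (\val F) q &
    forall G : KK X, between (\val G) q -> U G.
Proof.
pose B : set_system (KK X) := filter_from [set q | between (\val F) q]
  (fun q => [set G : KK X | between (\val G) q]).
have BF : Filter B.
  apply: filter_from_filter; first by exists (inr false, inr true).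
  move=> [u v] [u' v'] /andP[/= Fu Fv] /andP[/= Fu' Fv'].
  have [w Fw wP] := end_max Fu Fu'; have [z Fz zP] := end_min Fv Fv'.
  exists (w, z); first exact/andP.
  move=> G /andP[/= /(wP _ (set_mem (valP G)))/andP[Gu Gu']].
  by move=> /(zP _ (set_mem (valP G)))/andP[Gv Gv']; split; apply/andP.
suff : id @ B --> F by apply.
apply: (@cvg_ptws_sub _ _ bool (KK X)) => x; apply: cvg_near_cst.
case E : (\val F x).
  by exists (inr false, inl x) => // G /andP[].
exists (inl x, inr true); first by rewrite /= /between /= E.
by move=> G /andP[/= /negbTE].
Qed.

Lemma KK_finite_cover (R : realType) d (X : orderType d) (h : KK X -> R) (e : R) :
  continuous h -> (0 < e)%R ->
  exists Q : set ((X + bool) * (X + bool)), [/\ finite_set Q,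
    forall F : KK X, exists2 q, Q q & between (\val F) q &
    forall q, Q q -> forall F G : KK X, between (\val F) q -> between (\val G) q ->
      (`|h F - h G| < e)%R].
Proof.
move=> hc e0.
pose P (q : (X + bool) * (X + bool)) := forall F G : KK X,
  between (\val F) q -> between (\val G) q -> (`|h F - h G| < e)%R.
(* Compactness is used in its near-covering form: what holds eventually along [B] holds beyond some
   finite set of intervals on which [h] varies by less than [e]. *)
pose B : set_system (set ((X + bool) * (X + bool))) :=
  filter_from [set Q | finite_set Q /\ Q `<=` P] (fun Q => [set Q' | Q `<=` Q']).
have BF : Filter B.
  apply: filter_from_filter; first by exists set0; split; [exact: finite_set0|].
  move=> Q Q' [fQ QP] [fQ' QP']; exists (Q `|` Q').
    by split; [rewrite finite_setU|rewrite subUset].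
  by move=> S; rewrite /= subUset.
have [|Q [fQ QP] /(_ Q (@subset_refl _ Q)) Qc] := (compact_near_coveringP _).1
    (@KK_compact _ X) _ B (fun Q F => exists2 q, Q q & between (\val F) q) BF.
  move=> F _.
  have /cvgrPdist_lt /(_ (e / 2)%R) := hc F.
  rewrite divr_gt0 ?ltr0n // => /(_ isT)/between_nbhs[q Fq qP].
  exists ([set G | between (\val G) q], [set Q | Q q]).
    split; first exact: between_near.
    exists [set q]; last by move=> Q; apply; exact: erefl.
    split; [exact: finite_set1|move=> _ -> G G' /qP hG /qP hG'].
    rewrite (splitr e); apply: le_lt_trans (ltrD hG hG').
    by rewrite (distrC (h F) (h G)); apply: ler_distD.
  by move=> [G Q] /= [Gq Qq]; exists q.
exists Q; split => // F; exact: Qc.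
Qed.

(** * Separating families of intervals *)

Definition separating_family d (X : orderType d)
    (J : set ((X + bool) * (X + bool))) (D : set (X -> bool)) : Prop :=
  [/\ forall F G, final_segment F -> final_segment G ->
        (forall q, J q -> between F q = between G q) -> F = G,
      forall F, D F -> final_segment F,
      forall F, D F -> countable [set q | J q /\ between F q] &
      forall q F, final_segment F -> between F q -> exists2 G, D G & between G q].

(** Each coordinate and each [n] give a finite cover by intervals on which the coordinate varies by
    less than [1/(n+1)]. [J] keeps those on which it never vanishes, so an element with countable
    support lies in only countably many of them. *)
Lemma valdivia_separating_family (R : realType) d (X : orderType d) :
  valdivia R (KK X) -> exists J D, @separating_family d X J D.
Proof.
case=> _ [Gamma [K' [[f [g [fg gf fc gc]]] Kd]]].
pose h (c : Gamma) (F : KK X) : R := \val (f F) c.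
have hc c : continuous (h c).
  move=> F; apply: (@continuous_comp _ _ _ f (fun k : K' => \val k c)).
    exact: fc.
  exact: ptws_sub_coord_continuous.
have /choice[Q QP] (cn : Gamma * nat) := KK_finite_cover (hc cn.1)
  (e := (cn.2.+1%:R^-1)%R) ltac:(by rewrite invr_gt0 ltr0n).
pose J q := exists cn, Q cn q /\
  forall F : KK X, between (\val F) q -> h cn.1 F != 0%R.
pose D := [set \val F | F in [set F : KK X | countable [set c | h c F != 0%R]]].
exists J, D; split.
- have key (F G : KK X) c : h c F != h c G -> h c F != 0%R ->
      exists2 q, J q & between (\val F) q != between (\val G) q.
    move=> hFG hF.
    (* The bound by the distance keeps [G] out of the interval around [F]; the bound by the absolute
       value keeps the coordinate nonzero on it. *)
    have [n [n1 n2]] : exists n, (n.+1%:R^-1 < `|h c F - h c G|)%R /\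
      (n.+1%:R^-1 < `|h c F|)%R.
      pose e := Num.min `|h c F - h c G|%R `|h c F|%R.
      have e0 : (0 < e)%R by rewrite lt_min !normr_gt0 subr_eq0 hFG.
      have [n /=] := filter_ex (near_infty_natSinv_lt (PosNum e0)).
      by rewrite lt_min => /andP[? ?]; exists n.
    have [_ /(_ F)[q Qq Fq] /(_ _ Qq) Qdist] := QP (c, n).
    exists q; last first.
      rewrite Fq eq_sym eqb_id; apply/negP => Gq.
      by have := Qdist _ _ Fq Gq; rewrite ltNge (ltW n1).
    exists (c, n); split => // H Hq; apply/eqP => /= H0.
    by have := Qdist _ _ Fq Hq; rewrite /= H0 subr0 ltNge (ltW n2).
  move=> F G Ffin Gfin FG; apply: contrapT => nFG.
  pose F' : KK X := SigSub (mem_set Ffin); pose G' : KK X := SigSub (mem_set Gfin).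
  have [c hFG] : exists c, h c F' != h c G'.
    apply: contrapT => nc; apply: nFG.
    suff /(can_inj fg)[] : f F' = f G' by [].
    apply/val_inj/funext => c; apply: contrapT => /eqP ?.
    by apply: nc; exists c.
  have [hF|hF] := eqVneq (h c F') 0%R.
    have [||q /FG E] := key G' F' c; [by rewrite eq_sym|by rewrite -hF eq_sym|].
    by rewrite /= E eqxx.
  by have [//|//|q /FG E] := key F' G' c; rewrite /= E eqxx.
- by move=> _ [F _ <-]; exact: set_mem (valP F).
- move=> _ [F cF <-].
  apply: (@sub_countable _ _ _ (\bigcup_(cn in [set c | h c F != 0%R] `*` setT) Q cn)).
    apply: subset_card_le => q [[cn [Qq qP]] Fq]; exists cn => //.
    by split => //; exact: qP.
  apply: bigcup_countable; first exact: countableX.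
  by move=> cn _; apply: finite_set_countable; case: (QP cn).
- move=> q F Ffin Fq; pose F' : KK X := SigSub (mem_set Ffin).
  have [||k [kq ck]] := Kd [set k | between (\val (g k)) q].
  + by exists (f F'); rewrite /= fg.
  + rewrite openE => k kq; apply: (gc k [set F | between (\val F) q]).
    exact: between_near.
  + exists (\val (g k)) => //; exists (g k) => //=.
    by apply: sub_countable ck; apply: subset_card_le => c; rewrite /h gf.
Qed.

Definition flip_end (X : Type) (u : X + bool) : X + bool :=
  match u with inl x => inl x | inr b => inr (~~ b) end.

(** Complements of final segments are the final segments of the dual order, and complementation
    swaps and flips the endpoints of an interval. *)
Lemma separating_family_dual d (X : orderType d) J D :
  @separating_family d X J D ->
  @separating_family _ X^d
    [set q | J (flip_end q.2, flip_end q.1)] [set F | D (fun x => ~~ F x)].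
Proof.
have flipK (u : X + bool) : flip_end (flip_end u) = u.
  by case: u => //= b; rewrite negbK.
have evC (F : X -> bool) u : eval_end (fun x => ~~ F x) (flip_end u) = ~~ eval_end F u.
  by case: u.
have betC (F : X -> bool) q :
    between (fun x => ~~ F x) (flip_end q.2, flip_end q.1) = between F q.
  by rewrite /between /= !evC negbK andbC.
have finC (F : X -> bool) : @final_segment _ X^d F -> @final_segment d X (fun x => ~~ F x).
  by move=> Ffin x y xy; apply: contra => Fy; exact: (Ffin y x xy Fy).
have finC' (F : X -> bool) : @final_segment d X (fun x => ~~ F x) -> @final_segment _ X^d F.
  move=> Ffin x y xy; apply: contraLR => Fy; exact: (Ffin y x xy Fy).
have CK (F : X -> bool) : (fun x => ~~ ~~ F x) = F by apply/funext => x; rewrite negbK.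
move=> [sep Dfin Dc Dd]; split.
- move=> F G /finC Ffin /finC Gfin FG; rewrite -(CK F) -(CK G).
  congr (fun (H : X -> bool) x => ~~ H x); apply: sep => // q Jq.
  have E H : between (fun x => ~~ H x) q = between H (flip_end q.2, flip_end q.1).
    by have := betC H (flip_end q.2, flip_end q.1);
      rewrite /= !flipK -surjective_pairing.
  by rewrite !E; apply: FG; rewrite /= !flipK -surjective_pairing.
- by move=> F /Dfin /finC'.
- move=> F /Dc Fc; apply: sub_countable (Fc).
  pose h (q : (X + bool) * (X + bool)) := (flip_end q.2, flip_end q.1).
  apply: (card_le_trans (subset_card_le _) (card_image_le h _)).
  move=> q [Jq Fq]; exists (h q); last by rewrite /h /= !flipK -surjective_pairing.
  by split => //; rewrite betC.
- move=> q F /finC Ffin Fq; have [|G DG Gq] := Dd (flip_end q.2, flip_end q.1) _ Ffin.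
    by rewrite betC.
  exists (fun x => ~~ G x); first by rewrite /= CK.
  by rewrite -betC CK.
Qed.

Definition endpoints (X : Type) (J : set ((X + bool) * (X + bool)))
    (F : X -> bool) : set X :=
  [set x | exists q, [/\ J q, between F q & q.1 = inl x \/ q.2 = inl x]].

Lemma countable_endpoints (X : Type) J (F : X -> bool) :
  countable [set q | J q /\ between F q] -> countable (endpoints J F).
Proof.
move=> Fc; apply: (@sub_countable _ _ _ (\bigcup_(q in [set q | J q /\ between F q])
    [set x | q.1 = inl x \/ q.2 = inl x])).
  by apply: subset_card_le => x [q [Jq Fq qx]]; exists q.
apply: bigcup_countable => // -[u v] _ /=.
apply: countable_setU; apply/countable_injP; exists (fun=> 0%N) => x y;
  by rewrite !inE /= => -> [].
Qed.

Lemma separating_family_witness d (X : orderType d) J D :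
  @separating_family d X J D ->
  exists w : X -> X -> X -> bool, forall x y, x < y ->
    [/\ final_segment (w x y), ~~ w x y x, w x y y &
        countable (endpoints J (w x y))].
Proof.
move=> [_ Dfin Dc Dd].
have /choice[w wP] : forall q : X * X, exists F : X -> bool, q.1 < q.2 ->
    [/\ final_segment F, ~~ F q.1, F q.2 & countable (endpoints J F)].
  move=> [x y] /=; have [xy|] := pselect (x < y); last by exists xpredT.
  have [||F DF /andP[/= Fx Fy]] := Dd (inl x, inl y) (fun z => y <= z).
  - by move=> a b ab /= /le_trans; apply.
  - by rewrite /between /= lexx -ltNge xy.
  exists F => _; split => //; first exact: Dfin.
  exact/countable_endpoints/Dc.
by exists (fun x y => w (x, y)) => x y; exact: (wP (x, y)).
Qed.

(** A two-sided gap of [A] at [x] gives two final segments [F1] and [F2] that differ only inside the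
    gap. An interval of [J] containing exactly one of them has an endpoint in the gap and extends
    past two points of [A] on one side, so it contains the witness between these; closure then puts
    the endpoint into [A]. *)
Lemma endpoints_closed_retractable d (X : orderType d) J D
    (w : X -> X -> X -> bool) (A : set X) :
  @separating_family d X J D ->
  (forall x y, x < y -> [/\ final_segment (w x y), ~~ w x y x & w x y y]) ->
  (forall x y, A x -> A y -> x < y -> endpoints J (w x y) `<=` A) ->
  retractable A.
Proof.
move=> [sep _ _ _] wP Aw x nAx; apply: contrapT => /not_orP[nsucc npred].
have up : forall a, A a -> x < a -> exists b, [/\ A b, x < b & b < a].
  move=> a Aa xa; apply: contrapT => nb; apply: nsucc => _; exists a; split => //.
  by move=> b Ab xb; rewrite leNgt; apply/negP => ba; apply: nb; exists b.
have down : forall a, A a -> a < x -> exists b, [/\ A b, b < x & a < b].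
  move=> a Aa xa; apply: contrapT => nb; apply: npred => _; exists a; split => //.
  by move=> b Ab xb; rewrite leNgt; apply/negP => ba; apply: nb; exists b.
have [a1 [Aa1 xa1]] : exists a, A a /\ x < a.
  by apply: contrapT => na; apply: nsucc.
have [a0 [Aa0 a0x]] : exists a, A a /\ a < x.
  by apply: contrapT => na; apply: npred.
pose F1 z := `[< forall a, A a -> a < x -> a < z >].
pose F2 z := `[< exists a, [/\ A a, x < a & a <= z] >].
have F1fin : final_segment F1.
  move=> y z yz /asboolP Fy; apply/asboolP => a Aa ax.
  by apply: lt_le_trans yz; exact: Fy.
have F2fin : final_segment F2.
  move=> y z yz /asboolP[a [Aa xa ay]]; apply/asboolP; exists a; split => //.
  exact: le_trans yz.
have F21 z : F2 z -> F1 z.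
  move=> /asboolP[a [Aa xa az]]; apply/asboolP => b Ab bx.
  exact: lt_le_trans (lt_trans bx xa) az.
have F21e u : eval_end F2 u -> eval_end F1 u by case: u => //=; exact: F21.
have F12 : F1 <> F2.
  move=> /(congr1 (fun F => F x)) E.
  have : F1 x by apply/asboolP.
  rewrite E => /asboolP[a [Aa xa]]; by rewrite leNgt xa.
have gap z : F1 z -> ~ F2 z -> ~ A z.
  move=> /asboolP F1z F2z Az; case: (ltgtP x z) => [xz|zx|xz].
  - by apply: F2z; apply/asboolP; exists z.
  - by have := F1z _ Az zx; rewrite ltxx.
  - by apply: nAx; rewrite xz.
apply: F12; apply: sep => // -[u v] Jq; apply: contrapT => /eqP Fq.
case/boolP: (between F1 (u, v)) Fq => [/andP[/= u1 v1]|n1].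
- rewrite eq_sym eqb_id /between /= (contra (@F21e u) u1) /= => nv2.
  case: v v1 nv2 Jq => [z|[]//] /= z1 /negP z2 Jq.
  (* The left end is outside [F1], hence not above some [a] in [A] below [x]; a further point [b] of
     [A] between [a] and [x] exists because none is nearest. *)
  have [a [Aa ax ua]] : exists a, [/\ A a, a < x & forall F, final_segment F ->
      ~~ F a -> ~~ eval_end F u].
    case: u u1 Jq => [y|[]//] /= y1 _; last by exists a0.
    have [a [Aa ax ay]] : exists a, [/\ A a, a < x & y <= a].
      apply: contrapT => na; move/negP: y1; apply; apply/asboolP => a Aa ax.
      by rewrite ltNge; apply/negP => ya; apply: na; exists a.
    by exists a; split => // F Ffin; apply: contra; exact: Ffin.
  have [b [Ab bx ab]] := down _ Aa ax.
  have [wfin wa wb] := wP _ _ ab.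
  apply: (gap z) => //; apply: (Aw a b) => //.
  exists (u, inl z); split => //; last by right.
  apply/andP; split; first exact: ua.
  by apply: (wfin b z) => //; apply/ltW; move/asboolP: z1; apply.
- move=> F2q; have /andP[/= u2 v2] : between F2 (u, v).
    by case: (between F2 _) F2q.
  clear F2q.
  move: n1; rewrite /between /= (F21e _ v2) andbT negbK.
  case: u u2 Jq => [z|[]//] /= /negP z2 Jq z1.
  have [a [Aa ax va]] : exists a, [/\ A a, x < a & forall F, final_segment F ->
      F a -> eval_end F v].
    case: v v2 Jq => [y|[]//] /= y2 _; last by exists a1.
    move/asboolP: y2 => [a [Aa xa ay]].
    by exists a; split => // F Ffin; exact: Ffin.
  have [b [Ab bx ab]] := up _ Aa ax.
  have [wfin wb wa] := wP _ _ ab.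
  apply: (gap z) => //; apply: (Aw b a) => //.
  exists (inl z, v); split => //; last by left.
  apply/andP; split; last exact: va.
  apply: contra wb => /=; apply: wfin; rewrite leNgt; apply/negP => bz.
  by apply: z2; apply/asboolP; exists b; split => //; exact: ltW.
Qed.

(** * Cofinalities of cuts *)

Definition below d (X : orderType d) (u : X + bool) (x : X) : bool :=
  match u with inl m => x < m | inr b => b end.

(** Otherwise any union of [omega1] many countable sets is bounded under [u]. Left endpoints of
    intervals of [J] reaching up to [u] are then cofinal, yet only countably many lie under a given
    [z], since all those intervals contain one witness from [z] to a larger point. A strictly
    increasing [omega1]-sequence of such endpoints, itself bounded, contradicts this. *)
Lemma cofinal_below d (X : orderType d) J D (u : X + bool) :
  @separating_family d X J D ->
  exists B : omega1 -> set X, (forall a, countable (B a)) /\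
    forall z, below u z -> exists a b, [/\ B a b, below u b & z <= b].
Proof.
move=> SJD; have [sep _ _ _] := SJD; have [w wP] := separating_family_witness SJD.
apply: contrapT => nB.
have bnd (B : omega1 -> set X) : (forall a, countable (B a)) ->
    exists z, below u z /\ forall a b, B a b -> below u b -> b < z.
  move=> cB; apply: contrapT => nz; apply: nB; exists B; split => // z uz.
  apply: contrapT => nb; apply: nz; exists z; split => // a b Bb ub.
  by rewrite ltNge; apply/negP => zb; apply: nb; exists a, b.
have [a0 _] := omega1_bound (countable0 omega1).
have bndc (B : set X) : countable B ->
    exists z, below u z /\ forall b, B b -> below u b -> b < z.
  by move=> cB; have [z [uz zP]] := bnd (fun=> B) (fun=> cB); exists z; split => // b;
    exact: (zP a0).
have belowW x y : x <= y -> below u y -> below u x.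
  by case: u {nB bnd bndc} => //= m xy; exact: le_lt_trans.
have [x0 [ux0 _]] := bndc set0 (countable0 _).
pose top := eval_end (fun x => ~~ below u x).
pose P b := below u b /\ exists v, J (inl b, v) /\ top v.
have exP z : below u z -> exists b, P b /\ z < b.
  move=> uz.
  (* There is room between [x] and [y] for a witness [w x x'], and [y] exceeds all its endpoints
     under [u]. *)
  pose next x y := below u x -> below u y /\ exists x',
    [/\ x < x', x' < y & forall e, endpoints J (w x x') e -> below u e -> e < y].
  have exnext x : exists y, next x y.
    have [ux|nux] := pselect (below u x); last by exists x.
    have [x' [ux' /(_ x erefl ux) xx']] := bndc [set x] (countable1 x).
    have [_ _ _ cw] := wP _ _ xx'.
    have [y [uy yP]] := bndc _ (countable_setU (countable1 x') cw).
    exists y => _; split => //; exists x'; split => //.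
      by apply: yP => //; left.
    by move=> e xe; apply: yP; right.
  have [s [s0 sP]] := dependent_choice_from z exnext.
  have us n : below u (s n).
    by elim: n => [|n IH]; [rewrite s0|case: (sP n IH)].
  have [y [uy yP]] := bndc _ (countable_image s (countableP [set: nat])).
  (* [F1] is the cut just above the sequence, [F2] the cut at [u]. An interval of [J] containing
     only [F1] would contain some witness [w (s n) x'], forcing its right endpoint under [s n.+1];
     so a separating interval contains only [F2], and its left endpoint is the required [b]. *)
  pose F1 x := `[< forall n, s n < x >]; pose F2 x := ~~ below u x.
  have F1fin : final_segment F1.
    move=> a b ab /asboolP Fa; apply/asboolP => n; exact: lt_le_trans ab.
  have F2fin : final_segment F2.
    by move=> a b ab; apply: contra; exact: belowW.
  have F21 a : F2 a -> F1 a.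
    move=> na; apply/asboolP => n; rewrite ltNge; apply/negP => an.
    by move: na; rewrite /F2 (belowW _ _ an (us n)).
  have F21e v : eval_end F2 v -> eval_end F1 v by case: v => //=; exact: F21.
  have F12 : F1 <> F2.
    move=> /(congr1 (fun F => F y)); rewrite /F2 uy /=.
    by move=> /asboolPn; apply => n; apply: yP; [exists n|].
  apply: contrapT => nb; apply: F12; apply: sep => // -[v1 v2] Jq.
  apply: contrapT => /eqP Fq.
  case/boolP: (between F1 (v1, v2)) Fq => [/andP[/= n1 h2]|n1].
    rewrite eq_sym eqb_id /between /= (contra (@F21e v1) n1) /= => n2.
    case: v2 h2 n2 Jq => [c|[]//] /= /asboolP h2; rewrite /F2 negbK => uc Jq.
    have [n un] : exists n, forall F, final_segment F -> ~~ F (s n) ->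
        ~~ eval_end F v1.
      case: v1 n1 {Jq} => [e|[]//] /= n1; last by exists 0%N.
      have [n en] : exists n, e <= s n.
        apply: contrapT => nn; move/asboolPn: n1; apply => n.
        by rewrite ltNge; apply/negP => ne; apply: nn; exists n.
      by exists n => F Ffin; apply: contra; exact: Ffin.
    have [_ [x' [sx' x's xe]]] := sP n (us n).
    have [wfin ws wx' _] := wP _ _ sx'.
    have : c < s n.+1.
      apply: xe => //; exists (v1, inl c); split => //; last by right.
      apply/andP; split; first exact: un.
      by apply: (wfin x' c) => //; exact/ltW/(lt_trans x's).
    by rewrite ltNge (ltW (h2 _)).
  move=> F2q; have /andP[/= n2 h2] : between F2 (v1, v2).
    by case: (between F2 _) F2q.
  clear F2q; move: n1; rewrite /between /= (F21e _ h2) andbT negbK.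
  case: v1 n2 Jq => [b|[]//] /=; rewrite /F2 negbK => ub Jq /asboolP F1b.
  apply: nb; exists b; split; last by rewrite -s0.
  by split => //; exists v2.
have Pcount z : below u z -> countable [set b | P b /\ b <= z].
  move=> uz; have [z' [uz' /(_ z erefl uz) zz']] := bndc [set z] (countable1 z).
  have [wfin wz wz' cw] := wP _ _ zz'.
  apply: sub_countable cw; apply: subset_card_le => b [[ub [v [Jv tv]]] bz].
  exists (inl b, v); split => //; last by left.
  apply/andP; split; first by apply: contra wz => /=; exact: wfin.
  case: v tv {Jv} => //= c nuc; apply: (wfin z') => //.
  by rewrite leNgt; apply/negP => cz'; move: nuc; rewrite (belowW _ _ (ltW cz') uz').
have /choice[g gP] : forall z, exists b, below u z -> P b /\ z < b.
  move=> z; have [/exP[b bP]|nz] := pselect (below u z); first by exists b.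
  by exists z.
(* Each [c a] exceeds all earlier [g (c b)], so the points [g (c a)] increase strictly through
   [P]. *)
have [|c cP] := @omega1_recursion X (fun A t => (forall a, A a -> below u a) ->
    below u t /\ forall a, A a -> g a < t).
  move=> A cA; have [t [ut tP]] := bndc _ (countable_image g cA).
  exists t => Au; split => // a Aa; apply: tP; first by exists a.
  by have [[]] := gP _ (Au _ Aa).
have uc a : below u (c a).
  elim/(well_founded_ind omega1_wf) : a => a IH.
  by have [|] := cP a; first by move=> _ [b ba <-]; exact: IH.
have gc a b : b < a -> g (c b) < c a.
  by move=> ba; have [|_] := cP a; [move=> _ [e _ <-]|apply; exists b].
have [z [uz zP]] := bnd (fun a => [set c a]) (fun a => countable1 _).
apply: omega1_uncountable; apply: sub_countable (Pcount _ uz).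
suff /card_esym : (range (g \o c) #= [set: omega1])%card.
  rewrite card_eq_le => /andP[+ _] => /card_le_trans; apply; apply: subset_card_le.
  move=> _ [a _ <-] /=; split; first by case: (gP _ (uc a)).
  have [b [ab _]] := omega1_bound2 a a.
  by apply/ltW/(lt_trans (gc _ _ ab)); exact: (zP b).
apply: inj_card_eq => a b _ _ /=; case: (ltgtP a b) => // ab E; exfalso.
- have := lt_trans (gc _ _ ab) (gP _ (uc b)).2.
  by rewrite E ltxx.
- have := lt_trans (gc _ _ ab) (gP _ (uc a)).2.
  by rewrite E ltxx.
Qed.

(** First [X] is exhausted by closing the formal endpoints under endpoints of witnesses and under
    the cofinal and coinitial sets at each point, which bounds its cardinality. For any injection
    into [omega1], the levels closed under endpoints of witnesses then contain a club. *)
Lemma separating_family_filtrable d (X : orderType d) J D :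
  @separating_family d X J D -> filtrable X.
Proof.
move=> SJD; have [w wP] := separating_family_witness SJD.
have wP' x y : x < y -> [/\ final_segment (w x y), ~~ w x y x & w x y y].
  by move=> /wP[].
have /choice[B /all_and2[Bc Bcof]] := fun u => cofinal_below u SJD.
have /choice[B' /all_and2[B'c B'cof]] :=
  fun u => cofinal_below u (separating_family_dual SJD).
have cX : ([set: X] #<= [set: omega1])%card.
  pose E (u v : X + bool) : set X := match u, v with
    | inl x, inl y => if x < y then endpoints J (w x y) else set0
    | _, _ => set0 end.
  have cE u v : countable (E u v).
    case: u v => [x|?] [y|?] /=; try exact: countable0.
    by case: ifP => [/wP[]//|_]; exact: countable0.
  pose Phi (u v : X + bool) (a : omega1) : set (X + bool) :=
    inl @` (E u v `|` (B u a `|` B' u a)).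
  have [||M [cM M0 MS]] := @omega1_closure _ [set inr b | b in [set: bool]] Phi.
  - exact/countable_image/countableP.
  - move=> u v a; apply: countable_image; apply: countable_setU => //.
    by apply: countable_setU; [exact: Bc|exact: B'c].
  pose A x := exists a, M a (inl x).
  have MA u v a z : (exists b, M b u) -> (exists b, M b v) ->
      (E u v `|` (B u a `|` B' u a)) z -> A z.
    by move=> Mu Mv uvz; apply: (MS u v a (inl z) Mu Mv); exists z.
  have AE x y : A x -> A y -> x < y -> endpoints J (w x y) `<=` A.
    move=> Ax Ay xy z zE; have [a _] := Ax.
    by apply: (MA (inl x) (inl y) a) => //; left; rewrite /= xy.
  have Mend b : exists a, M a (inr b) by apply: M0; exists b.
  have Aret := endpoints_closed_retractable SJD wP' AE.
  have neq x b : ~ A x -> A b -> x != b by move=> nAx Ab; apply/eqP => xb; rewrite xb in nAx.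
  apply: (@card_le_omega1 _ (fun a => [set x | M a (inl x)])) => [a|x].
    apply: sub_countable (cM a); apply: card_ge_preimage => x y _ _; exact: inl_inj.
  (* A missing [x] has no nearest point [m] of [A] above it, as [A] is cofinal below [m], and it has
     points of [A] above it, as [A] is cofinal in [X]. The other side is dual. *)
  apply: contrapT => nAx; case: (Aret x nAx) => Ax.
  - have above u : (exists a, M a u) -> below u x -> exists b, [/\ A b, x < b & below u b].
      move=> Mu /Bcof[a [b [uab ub xb]]].
      have Ab : A b by apply: (MA u u a) => //; right; left.
      by exists b; split => //; rewrite lt_neqAle xb neq.
    have [a Ma] : exists a, A a /\ x < a.
      by have [b [Ab xb _]] := above (inr true) (Mend _) isT; exists b.
    have [m [Am xm mmin]] := Ax (ex_intro _ a Ma).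
    have [b [Ab xb]] := above (inl m) Am xm.
    by rewrite /= ltNge mmin.
  - have under u : (exists a, M a u) -> @below _ X^d u x ->
        exists b, [/\ A b, b < x & @below _ X^d u b].
      move=> Mu /B'cof[a [b [uab ub xb]]].
      have Ab : A b by apply: (MA u u a) => //; right; right.
      exists b; split => //; rewrite lt_neqAle eq_sym neq //.
    have [a Ma] : exists a, A a /\ a < x.
      by have [b [Ab xb _]] := under (inr true) (Mend _) isT; exists b.
    have [m [Am xm mmin]] := Ax (ex_intro _ a Ma).
    have [b [Ab xb bm]] := under (inl m) Am xm.
    have : m < b by exact: bm.
    by rewrite ltNge mmin.
have [rho rinj] := card_le_omega1_inj cX.
(* All pairs of rank at most [c] are treated at once, so that closure under a one-variable operation
   covers each pair through its larger rank. *)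
pose Phi c := \bigcup_(q in [set x | rho x <= c] `*` [set x | rho x <= c])
  [set rho z | z in [set z | q.1 < q.2 /\ endpoints J (w q.1 q.2) z]].
have cPhi c : countable (Phi c).
  have cc : countable [set x | rho x <= c].
    apply: sub_countable (omega1_initial_countable c).
    by apply: card_ge_preimage => x y _ _ /rinj.
  apply: bigcup_countable; first exact: countableX.
  move=> [x y] _; apply: countable_image => /=.
  have [xy|nxy] := boolP (x < y); last first.
    by rewrite (_ : mkset _ = set0)//; apply/seteqP; split => // z [].
  have [_ _ _] := wP _ _ xy; apply: sub_countable.
  by apply: subset_card_le => z [].
have [a0 _] := omega1_bound (countable0 omega1).
have [C [clC CP]] := club_closure a0 (club_ge a0) cPhi.
exists rho, C; split => // a /CP[_ _ Ca].
apply: (endpoints_closed_retractable SJD wP') => x y /= xa ya xy z zE.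
apply: (Ca (Order.max (rho x) (rho y))); first by rewrite gt_max xa.
by exists (x, y); [rewrite /= !le_max !lexx orbT|exists z].
Qed.

Theorem theorem3p1 (R : realType) (d : Order.disp_t) (X : orderType d) :
  valdivia R (KK X) <->
  [/\ ([set: X] #<= [set: omega1])%card,
      (forall x : omega1 -> X, {homo x : a b / a <= b} ->
         has_ubound (range x) -> supremums (range x) !=set0) /\
      (forall x : omega1 -> X, {homo x : a b / a <= b >-> b <= a} ->
         has_lbound (range x) -> infimums (range x) !=set0)
    & forall (S : set omega1) (f : S -> X), stationary S ->
        exists T : set omega1,
          [/\ stationary T, T `<=` S
            & (forall a b : S, T (\val a) -> T (\val b) ->
                 \val a <= \val b -> f a <= f b) \/
              (forall a b : S, T (\val a) -> T (\val b) ->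
                 \val a <= \val b -> f b <= f a)]].
Proof.
rewrite -filtrableP; split; last exact: filtrable_valdivia.
by move=> /valdivia_separating_family[J [D]]; exact: separating_family_filtrable.
Qed.
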